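(* Let $\alpha$ be a partition with all parts $\ge 2$ and overlapping partition $p=(p_1,\dots,p_{\ell(\alpha)-1},0)$, and for $1\le i\le \ell(p)-1$ let $\varrho_i=1+\sum_{q=i+1}^{\ell(\alpha)}\alpha_q-p_{i+1}$. Then $[R_\alpha^p]=[\alpha,(|\alpha|-p_1,p_1)]$ if and only if either $\ell(p)<2$, or $\ell(p)\ge2$ and $$\sum_{j=1}^i[\varrho_i-\alpha_j]_+\ge p_{i+1}\quad\text{for every } 1\le i\le \ell(p)-1.$$
   Context: A partition $\alpha=(\alpha_1\ge\dots\ge\alpha_{\ell(\alpha)}>0)$ has length $\ell(\alpha)$ and size $|\alpha|$. A ribbon is a skew Young diagram (English convention) containing no $2\times2$ square. For a partition $\alpha$ with all parts $\ge2$, a ribbon $R_\alpha$ has rows, from top to bottom, of lengths $\alpha_1,\dots,\alpha_{\ell(\alpha)}$, consecutive rows sharing at most one column and non-consecutive rows sharing none. Its overlapping partition is $p=(p_1,\dots,p_{\ell(\alpha)-1},0)$ where $p_i$ is the number of columns of length two in the last $\ell(\alpha)-i+1$ rows; $\ell(p)$ is the number of nonzero parts of $p$. The ribbon is determined by $(\alpha,p)$ and denoted $R_\alpha^p$. For a skew shape $A$, $s_A=\sum_\nu c_A^\nu s_\nu$ and the Schur support is $[A]=\{\nu:c_A^\nu>0\}$. $\preceq$ is dominance order and $[\lambda,\mu]=\{\nu:\lambda\preceq\nu\preceq\mu\}$. For real $x$, $[x]_+=\max\{0,x\}$. *)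

(* Defs.v *)
From mathcomp Require Import all_boot all_order all_algebra.
From mathcomp Require Import mpoly.

Set Implicit Arguments.
Unset Strict Implicit.
Unset Printing Implicit Defensive.

Import Order.TTheory GRing.Theory Num.Theory.

Local Open Scope nat_scope.

Definition is_partition (s : seq nat) : bool := sorted geq s && (0 \notin s).

(* The entry with 1-based index [i], and 0 beyond the last entry; only used
   with [1 <= i]. *)
Definition part (s : seq nat) (i : nat) : nat := nth 0 s i.-1.

Definition num_nonzero (s : seq nat) : nat := count (fun x => 0 < x) s.

(* All partitions of [k]: they have at most [k] parts, each at most [k]. *)
Definition partitions (k : nat) : seq (seq nat) :=
  [seq s <- [seq map val t | t : k.-bseq 'I_k.+1 <- enum {: k.-bseq 'I_k.+1}]
     | is_partition s && (sumn s == k)].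

Lemma partitions_uniq k : uniq (partitions k).
Proof.
rewrite filter_uniq // map_inj_uniq ?enum_uniq // => s t /= eq_st.
by apply: val_inj; apply: (inj_map val_inj).
Qed.

Lemma mem_partitions k s :
  (s \in partitions k) = is_partition s && (sumn s == k).
Proof.
rewrite mem_filter andb_idr // => /andP[/andP[_ s_pos] /eqP sum_s].
have le_part x : x \in s -> x <= k.
  by rewrite -sum_s => xs; rewrite (perm_sumn (perm_to_rem xs)) leq_addr.
have le_size : size s <= k.
  rewrite -sum_s; elim: s s_pos {sum_s le_part} => //= x s IHs.
  by rewrite inE negb_or eq_sym -lt0n => /andP[x0 /IHs]; rewrite -add1n; apply: leq_add.
have size_t : size [seq inord x : 'I_k.+1 | x <- s] <= k by rewrite size_map.
apply/mapP; exists (Bseq size_t); first by rewrite mem_enum.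
rewrite /= -map_comp -[LHS]map_id; apply/eq_in_map => x xs /=.
by rewrite inordK // ltnS le_part.
Qed.

Definition dominated (lam nu : seq nat) : Prop :=
  sumn lam = sumn nu /\
  forall k : nat, sumn (take k lam) <= sumn (take k nu).

(* Trailing zeros in [lam] or [mu] do not affect the interval. *)
Definition in_dominance_interval (lam mu nu : seq nat) : Prop :=
  [/\ is_partition nu, dominated lam nu & dominated nu mu].

Definition is_skew_shape (lam mu : seq nat) : Prop :=
  [/\ is_partition lam, is_partition mu &
      forall i, 1 <= i -> part mu i <= part lam i].

(* The cells (row, column) of lam / mu, numbered from 1, in the English
   convention. *)
Definition diagram (lam mu : seq nat) : seq (nat * nat) :=
  [seq (i, j) | i <- iota 1 (size lam),
                j <- iota (part mu i).+1 (part lam i - part mu i)].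

Definition is_ssyt (D : seq (nat * nat)) (n : nat)
    (T : {ffun seq_sub D -> 'I_n}) : bool :=
  [forall x, forall y,
     (((val x).1 == (val y).1) && ((val x).2 < (val y).2) ==> (T x <= T y)) &&
     (((val x).2 == (val y).2) && ((val x).1 < (val y).1) ==> (T x < T y))].

Definition skew_schur (n : nat) (lam mu : seq nat) : {mpoly int[n]} :=
  (\sum_(T : {ffun seq_sub (diagram lam mu) -> 'I_n} | is_ssyt T)
     \prod_x 'X_(T x))%R.

Definition schur (n : nat) (nu : seq nat) : {mpoly int[n]} :=
  skew_schur n nu [::].

(* [c nu] is the coefficient of s_nu in s_{lam / mu}. An identity between
   symmetric functions is one that holds in every finite number of variables;
   as s_{lam / mu} is homogeneous, only the partitions of |lam / mu| occur. *)
Definition is_schur_expansion (lam mu : seq nat) (c : seq nat -> int) : Prop :=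
  let k := size (diagram lam mu) in
  (forall n : nat,
     skew_schur n lam mu = \sum_(nu <- partitions k) c nu *: schur n nu)%R /\
  (forall nu, nu \notin partitions k -> c nu = 0%R).

(* The Schur functions form a basis, so the expansion exists and is unique. *)
Definition in_schur_support (lam mu nu : seq nat) : Prop :=
  exists c : seq nat -> int, is_schur_expansion lam mu c /\ (0 < c nu)%R.

Definition no_2x2_square (D : seq (nat * nat)) : Prop :=
  forall i j, ~ [/\ (i, j) \in D, (i, j.+1) \in D,
                    (i.+1, j) \in D & (i.+1, j.+1) \in D].

Definition shared_columns (lam mu : seq nat) (r s : nat) : nat :=
  count (fun j => ((r, j) \in diagram lam mu) && ((s, j) \in diagram lam mu))
        (iota 1 (part lam 1)).

(* lam / mu is a ribbon with row lengths [alpha], from top to bottom. *)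
Definition is_ribbon (alpha lam mu : seq nat) : Prop :=
  [/\ is_skew_shape lam mu,
      no_2x2_square (diagram lam mu),
      alpha = [seq part lam i - part mu i | i <- iota 1 (size lam)],
      forall r, 1 <= r < size lam -> shared_columns lam mu r r.+1 <= 1 &
      forall r s, 1 <= r -> r.+1 < s <= size lam -> shared_columns lam mu r s = 0].

(* The number of cells of column [j] in the rows [i], [i.+1], ... *)
Definition column_length_from (lam mu : seq nat) (i j : nat) : nat :=
  count (fun x => (i <= x.1) && (x.2 == j)) (diagram lam mu).

Definition overlapping_partition (lam mu : seq nat) : seq nat :=
  [seq count (fun j => column_length_from lam mu i j == 2) (iota 1 (part lam 1))
     | i <- iota 1 (size lam)].

Definition pos_part (x : int) : int := Num.max 0%R x.

Definition varrho (alpha p : seq nat) (i : nat) : int :=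
  (1 + \sum_(i.+1 <= q < (size alpha).+1) (part alpha q)%:Z
     - (part p i.+1)%:Z)%R.

(* Main.v *)
Require Import Defs.
From mathcomp Require Import all_boot all_order all_algebra.
From mathcomp Require Import mpoly zify.

(** Reading the rows of the ribbon from top to bottom, each from right to left,
    turns its tableaux into words that are weakly decreasing along the rows and
    strictly increasing at the overlaps. Dropping an overlap condition, or
    replacing it by its opposite (which merges the two rows), gives a recursion
    that ends with products of complete homogeneous polynomials. Chains of
    horizontal strips satisfy the same recursion and, by the Pieri rule, the same
    initial conditions. Hence [c_nu] counts the chains
    [nu = nu^0 > nu^1 > ... > nu^l = 0] of horizontal strips of sizes
    [alpha_1, ..., alpha_l] in which every overlap forces a descent.

    With [A_i = alpha_i + ... + alpha_(l-1)] and [p_i] the number of overlaps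
    from row [i] on (indices from 0), such a chain exists if and only if [nu]
    dominates [alpha] and [nu_i + p_i <= A_i] for all [i]. Necessity holds because
    [nu_i] is at most the first row of [nu^i] and each descent puts a cell outside
    the first row. For sufficiency, [nu^1] is the most dominant partition that
    respects these bounds and misses the last cell of the last longest row of [nu].
    The inequality of the theorem for [i] says exactly that no partition that
    dominates [alpha] violates the bound at [i]. *)

Set Implicit Arguments.
Unset Strict Implicit.
Unset Printing Implicit Defensive.

Import Order.TTheory GRing.Theory Num.Theory.

Local Notation "s `_ i" := (nth 0%N s i) : nat_scope.

(** * Partitions and horizontal strips *)

(* [big_ord_recr] and [big_ord_recl] for summands on [nat]: no [widen_ord] or [lift] is left
   to simplify. *)
Lemma sum_ord_recr (f : nat -> nat) n : \sum_(i < n.+1) f i = \sum_(i < n) f i + f n.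
Proof. exact: big_ord_recr. Qed.

Lemma sum_ord_recl (f : nat -> nat) n : \sum_(i < n.+1) f i = f 0 + \sum_(i < n) f i.+1.
Proof. exact: big_ord_recl. Qed.

Lemma sumn_take_sum (s : seq nat) k : sumn (take k s) = \sum_(i < k) s`_i.
Proof.
elim: s k => [|x s IHs] [|k] //=; rewrite ?big_ord0 //.
  by rewrite big1 // => i _; rewrite nth_nil.
by rewrite big_ord_recl /= IHs.
Qed.

Lemma sum_nth_sumn (s : seq nat) k : size s <= k -> \sum_(i < k) s`_i = sumn s.
Proof. by move=> lesk; rewrite -sumn_take_sum take_oversize. Qed.

Lemma sumn_takeS (s : seq nat) i : sumn (take i.+1 s) = sumn (take i s) + s`_i.
Proof. by rewrite !sumn_take_sum big_ord_recr. Qed.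

Lemma leq_sumn_take (s : seq nat) k : sumn (take k s) <= sumn s.
Proof. by rewrite -{2}(cat_take_drop k s) sumn_cat leq_addr. Qed.

Lemma leq_sumn_nth (s t : seq nat) : (forall i, s`_i <= t`_i) -> sumn s <= sumn t.
Proof.
move=> le_st; rewrite -(@sum_nth_sumn s (size s + size t)) ?leq_addr //.
by rewrite -(@sum_nth_sumn t (size s + size t)) ?leq_addl //; apply: leq_sum.
Qed.

Lemma ltn_sumn_nth (s t : seq nat) k :
  (forall i, s`_i <= t`_i) -> s`_k < t`_k -> sumn s < sumn t.
Proof.
move=> le_st lt_k; rewrite -(cat_take_drop k.+1 s) -(cat_take_drop k.+1 t) !sumn_cat !sumn_takeS.
have le_take : sumn (take k s) <= sumn (take k t).
  by rewrite !sumn_take_sum; apply: leq_sum.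
have le_drop : sumn (drop k.+1 s) <= sumn (drop k.+1 t).
  by apply: leq_sumn_nth => i; rewrite !nth_drop.
lia.
Qed.

Definition nonincreasing (f : nat -> nat) := forall i, f i.+1 <= f i.

Lemma nonincreasing_leq f i j : nonincreasing f -> i <= j -> f j <= f i.
Proof.
move=> f_dec; apply: (@homo_leq _ f (fun x y => y <= x)) => // y x z xy yz.
exact: leq_trans yz xy.
Qed.

Lemma sorted_geqP (s : seq nat) : reflect (nonincreasing (nth 0 s)) (sorted geq s).
Proof.
apply: (iffP (sortedP 0)) => [srt i|s_dec i _]; last exact: s_dec.
by case: (ltnP i.+1 (size s)) => [/srt|le_s] //; rewrite nth_default.
Qed.

Lemma partition_nonincreasing s : is_partition s -> nonincreasing (nth 0 s).
Proof. by case/andP=> /sorted_geqP. Qed.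

Lemma partition_nth_leq s i j : is_partition s -> i <= j -> s`_j <= s`_i.
Proof. by move/partition_nonincreasing/nonincreasing_leq; apply. Qed.

Lemma partition_nth_gt0 s i : is_partition s -> (0 < s`_i) = (i < size s).
Proof.
case/andP=> _ s_pos; case: (ltnP i (size s)) => [lt_i|le_i]; last by rewrite nth_default.
by rewrite lt0n; apply: contra s_pos => /eqP <-; apply: mem_nth.
Qed.

Lemma partition_size_leq s k : is_partition s -> s`_k = 0 -> size s <= k.
Proof. by move=> ps s_k; rewrite leqNgt -partition_nth_gt0 // s_k. Qed.

Lemma partition_ext s t : is_partition s -> is_partition t ->
  (forall i, s`_i = t`_i) -> s = t.
Proof.
move=> ps pt eq_st; apply: (@eq_from_nth _ 0) => [|i _]; last exact: eq_st.
apply/eqP; rewrite eqn_leq !partition_size_leq //.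
  by rewrite -eq_st nth_default.
by rewrite eq_st nth_default.
Qed.

Lemma partition_size_leq_sumn s : is_partition s -> size s <= sumn s.
Proof.
by case/andP=> _; elim: s => //= x s IHs; rewrite inE negb_or => /andP[x0 /IHs]; lia.
Qed.

Lemma partition_sumn0 s : is_partition s -> (sumn s == 0) = (s == [::]).
Proof.
move=> ps; apply/eqP/eqP => [s0|-> //]; apply: size0nil.
by apply/eqP; rewrite -leqn0 -s0 partition_size_leq_sumn.
Qed.

Definition drop_zeros (s : seq nat) := [seq x <- s | 0 < x].

Lemma drop_zeros_partition s : sorted geq s -> is_partition (drop_zeros s).
Proof.
move=> srt; rewrite /is_partition mem_filter andbT sorted_filter //.
by move=> x y z /= xy yz; apply: leq_trans yz xy.
Qed.

Lemma nth_drop_zeros s i : sorted geq s -> (drop_zeros s)`_i = s`_i.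
Proof.
elim: s i => //= x s IHs i path_s; have /IHs {}IHs := path_sorted path_s.
case: posnP => [x0|_]; last by case: i => [|i] /=.
have x_max j : (x :: s)`_j <= x.
  by apply: (@nonincreasing_leq (nth 0 (x :: s)) 0) => //; apply/sorted_geqP.
by have := x_max i; have := x_max i.+1; rewrite IHs /= x0; lia.
Qed.

Lemma sumn_drop_zeros s : sumn (drop_zeros s) = sumn s.
Proof. by elim: s => //= x s IHs; case: posnP => [->|_] /=; rewrite IHs. Qed.

Lemma drop_zeros_partition_id s : is_partition s -> drop_zeros s = s.
Proof.
case/andP=> _ s_pos; apply/all_filterP/allP => x s_x; rewrite lt0n.
by apply: contraNneq s_pos => <-.
Qed.

Lemma behead_drop_zeros s : sorted geq s -> behead (drop_zeros s) = drop_zeros (behead s).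
Proof.
case: s => //= x s path_s; case: posnP => //= x0.
suff /size0nil -> : size (drop_zeros s) = 0 by [].
apply/eqP; rewrite -leqn0 partition_size_leq ?drop_zeros_partition ?(path_sorted path_s) //.
rewrite nth_drop_zeros ?(path_sorted path_s) //.
by case: s path_s => //= y s /andP[]; rewrite x0 leqn0 => /eqP.
Qed.

Lemma behead_partition s : is_partition s -> is_partition (behead s).
Proof.
by case: s => //= x s /andP[/path_sorted srt]; rewrite inE negb_or /is_partition srt => /andP[].
Qed.

Lemma sumn_behead s : sumn s = s`_0 + sumn (behead s).
Proof. by case: s. Qed.

Definition partition_of (f : nat -> nat) k := drop_zeros (mkseq f k).

Section PartitionOf.
Variables (f : nat -> nat) (k : nat).
Hypotheses (f_dec : nonincreasing f) (f_k : f k = 0).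

Let nth_mkseq_of i : (mkseq f k)`_i = f i.
Proof.
case: (ltnP i k) => [lt_ik|le_ki]; first by rewrite nth_mkseq.
by rewrite nth_default ?size_mkseq //; have := nonincreasing_leq f_dec le_ki; lia.
Qed.

Let mkseq_sorted : sorted geq (mkseq f k).
Proof. by apply/sorted_geqP => i; rewrite !nth_mkseq_of. Qed.

Lemma partition_of_partition : is_partition (partition_of f k).
Proof. exact: drop_zeros_partition mkseq_sorted. Qed.

Lemma nth_partition_of i : (partition_of f k)`_i = f i.
Proof. by rewrite nth_drop_zeros ?nth_mkseq_of ?mkseq_sorted. Qed.

Lemma sumn_partition_of : sumn (partition_of f k) = \sum_(i < k) f i.
Proof.
rewrite sumn_drop_zeros -(@sum_nth_sumn _ k) ?size_mkseq //.
by apply: eq_bigr => i _; rewrite nth_mkseq_of.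
Qed.

Lemma size_partition_of : size (partition_of f k) <= k.
Proof. by rewrite partition_size_leq ?partition_of_partition ?nth_partition_of. Qed.

End PartitionOf.

Lemma partitions0 : partitions 0 = [:: [::]].
Proof.
apply/perm_small_eq => //; apply: uniq_perm; rewrite ?partitions_uniq // => s.
rewrite mem_partitions inE; apply/andP/eqP => [[ps]|-> //].
by rewrite partition_sumn0 // => /eqP.
Qed.

Definition partitions_upto n := undup (flatten [seq partitions k | k <- iota 0 n.+1]).

Lemma partitions_upto_uniq n : uniq (partitions_upto n).
Proof. exact: undup_uniq. Qed.

Lemma mem_partitions_upto n s :
  (s \in partitions_upto n) = is_partition s && (sumn s <= n).
Proof.
rewrite mem_undup; apply/flatten_mapP/andP => [[k]|[ps le_sn]].
  by rewrite mem_iota => lt_kn; rewrite mem_partitions => /andP[-> /eqP ->]; lia.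
by exists (sumn s); rewrite ?mem_iota ?mem_partitions ?ps /=; lia.
Qed.

Lemma perm_partitions k n : k <= n ->
  perm_eq (partitions k) [seq s <- partitions_upto n | sumn s == k].
Proof.
move=> le_kn; apply: uniq_perm => [||s]; rewrite ?partitions_uniq ?filter_uniq ?undup_uniq //.
by rewrite mem_partitions mem_filter mem_partitions_upto andbC;
   case: eqP => //= ->; rewrite le_kn andbT.
Qed.

(* [nu / ka] is a horizontal strip: it has at most one cell in each column. *)
Definition hstrip (nu ka : seq nat) :=
  all (fun i => nu`_i.+1 <= ka`_i <= nu`_i) (iota 0 (size nu + size ka)).

Lemma hstripP nu ka : reflect (forall i, nu`_i.+1 <= ka`_i <= nu`_i) (hstrip nu ka).
Proof.
apply: (iffP allP) => [strip i|strip i _]; last exact: strip.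
case: (ltnP i (size nu + size ka)) => [lt_i|le_i]; first by apply: strip; rewrite mem_iota.
by rewrite !nth_default //; lia.
Qed.

Lemma hstrip_sumn nu ka : hstrip nu ka -> sumn ka <= sumn nu.
Proof.
by move/hstripP=> strip; apply: leq_sumn_nth => i; case/andP: (strip i).
Qed.

(** * The Pieri rule *)

Lemma leq_size_can (T1 T2 : eqType) (s1 : seq T1) (s2 : seq T2) (f : T1 -> T2) g :
  uniq s1 -> {in s1, forall x, f x \in s2} -> {in s1, cancel f g} -> size s1 <= size s2.
Proof.
move=> s1_uniq f_s2 fK; rewrite -(size_map f); apply: uniq_leq_size => [|_ /mapP[x s1x ->]].
  by rewrite map_inj_in_uniq //; apply: can_in_inj fK.
exact: f_s2.
Qed.

(* The local rule of the Robinson-Schensted-Knuth correspondence. The partitions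
   below both [nu] and [ka] are those whose rows lie in the intervals of
   [interlacing]. The same holds, after deletion of the first row, for the
   partitions above both. Reflecting each row in its interval exchanges the two. *)
Section LocalRule.
Variables nu ka : seq nat.
Hypotheses (nu_part : is_partition nu) (ka_part : is_partition ka).

Definition interlacing (s : seq nat) :=
  forall i, maxn nu`_i.+1 ka`_i.+1 <= s`_i <= minn nu`_i ka`_i.

Lemma hstrip_belowP s : reflect (interlacing s) (hstrip nu s && hstrip ka s).
Proof.
apply: (iffP andP) => [[/hstripP strip_nu /hstripP strip_ka] i|inter].
  by have := strip_nu i; have := strip_ka i; lia.
by split; apply/hstripP => i; have := inter i; lia.
Qed.

Lemma hstrip_aboveP t :
  reflect (interlacing (behead t) /\ maxn nu`_0 ka`_0 <= t`_0) (hstrip t nu && hstrip t ka).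
Proof.
apply: (iffP andP) => [[/hstripP strip_nu /hstripP strip_ka]|[inter t0]].
  split=> [i|]; last by have := strip_nu 0; have := strip_ka 0; lia.
  have := strip_nu i; have := strip_ka i; have := strip_nu i.+1; have := strip_ka i.+1.
  by rewrite nth_behead; lia.
split; apply/hstripP => -[|i].
- by have := inter 0; rewrite nth_behead; lia.
- by have := inter i; have := inter i.+1; rewrite !nth_behead; lia.
- by have := inter 0; rewrite nth_behead; lia.
- by have := inter i; have := inter i.+1; rewrite !nth_behead; lia.
Qed.

Definition reflect_rows (s : seq nat) :=
  partition_of (fun i => maxn nu`_i.+1 ka`_i.+1 + minn nu`_i ka`_i - s`_i) (size nu + size ka).

Section Reflection.
Variable s : seq nat.
Hypothesis s_inter : interlacing s.

Let row i := maxn nu`_i.+1 ka`_i.+1 + minn nu`_i ka`_i - s`_i.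

Let row_dec : nonincreasing row.
Proof. by move=> i; rewrite /row; have := s_inter i; have := s_inter i.+1; lia. Qed.

Let row_size : row (size nu + size ka) = 0.
Proof. by rewrite /row [nu`__]nth_default ?[ka`__]nth_default; lia. Qed.

Lemma reflect_rows_partition : is_partition (reflect_rows s).
Proof. exact: partition_of_partition row_dec row_size. Qed.

Lemma nth_reflect_rows i : (reflect_rows s)`_i = row i.
Proof. exact: nth_partition_of row_dec row_size i. Qed.

Lemma reflect_rows_interlacing : interlacing (reflect_rows s).
Proof. by move=> i; rewrite nth_reflect_rows /row; have := s_inter i; lia. Qed.

Lemma sumn_reflect_rows : is_partition s ->
  sumn s + sumn (reflect_rows s) + maxn nu`_0 ka`_0 = sumn nu + sumn ka.
Proof.
move=> s_part; set k := size nu + size ka.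
have size_s : size s <= k.
  apply: partition_size_leq => //; have := s_inter k.
  by rewrite [nu`_k]nth_default /k; lia.
have max_shift : \sum_(i < k) maxn nu`_i.+1 ka`_i.+1 + maxn nu`_0 ka`_0 =
                 \sum_(i < k) maxn nu`_i ka`_i.
  transitivity (\sum_(i < k.+1) maxn nu`_i ka`_i); first by rewrite big_ord_recl addnC.
  by rewrite big_ord_recr /= [nu`_k]nth_default ?[ka`_k]nth_default /k; lia.
have max_min : \sum_(i < k) maxn nu`_i ka`_i + \sum_(i < k) minn nu`_i ka`_i = sumn nu + sumn ka.
  rewrite -!(@sum_nth_sumn _ k) /k ?leq_addl ?leq_addr // -!big_split /=.
  by apply: eq_bigr => i _; lia.
have rows : sumn s + sumn (reflect_rows s) =
    \sum_(i < k) maxn nu`_i.+1 ka`_i.+1 + \sum_(i < k) minn nu`_i ka`_i.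
  rewrite sumn_partition_of // -/k -(sum_nth_sumn size_s) -!big_split /=.
  by apply: eq_bigr => i _; have := s_inter i; lia.
lia.
Qed.

End Reflection.

Lemma reflect_rowsK s : is_partition s -> interlacing s -> reflect_rows (reflect_rows s) = s.
Proof.
move=> s_part s_inter; have r_inter := reflect_rows_interlacing s_inter.
apply: partition_ext => // [|i]; first exact: reflect_rows_partition.
by rewrite !nth_reflect_rows //; have := s_inter i; lia.
Qed.

Variable a : nat.

Definition below s := [/\ is_partition s, interlacing s & sumn ka <= sumn s + a].
Definition above t := [/\ is_partition t, sumn t = sumn nu + a,
  interlacing (behead t) & maxn nu`_0 ka`_0 <= t`_0].

Definition raise s := drop_zeros (sumn nu + a - sumn (reflect_rows s) :: reflect_rows s).
Definition lower t := reflect_rows (behead t).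

Lemma raise_sorted s : below s ->
  sorted geq (sumn nu + a - sumn (reflect_rows s) :: reflect_rows s).
Proof.
case=> ps inter le_ka; apply/sorted_geqP => -[|i] /=.
  by have := sumn_reflect_rows inter ps; have := reflect_rows_interlacing inter 0; lia.
exact: partition_nonincreasing (reflect_rows_partition inter) i.
Qed.

Lemma behead_raise s : below s -> behead (raise s) = reflect_rows s.
Proof.
move=> s_below; rewrite behead_drop_zeros ?raise_sorted //=.
by case: s_below => _ inter _; rewrite drop_zeros_partition_id ?reflect_rows_partition.
Qed.

Lemma raise_above s : below s -> above (raise s).
Proof.
move=> s_below; have srt := raise_sorted s_below; rewrite /above behead_raise //.
case: s_below => ps inter le_ka; have sum_s := sumn_reflect_rows inter ps.
split.
- exact: drop_zeros_partition.
- by rewrite sumn_drop_zeros /=; lia.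
- exact: reflect_rows_interlacing.
- by rewrite nth_drop_zeros //=; lia.
Qed.

Lemma lower_below t : above t -> below (lower t).
Proof.
case=> pt sum_t inter le0; have pb := behead_partition pt; split.
- exact: reflect_rows_partition.
- exact: reflect_rows_interlacing.
- by have := sumn_reflect_rows inter pb; rewrite sumn_behead in sum_t; rewrite -/(lower t); lia.
Qed.

Lemma raiseK s : below s -> lower (raise s) = s.
Proof.
by move=> s_below; rewrite /lower behead_raise //; case: s_below => *; apply: reflect_rowsK.
Qed.

Lemma lowerK t : above t -> raise (lower t) = t.
Proof.
case=> pt sum_t inter _.
rewrite /raise /lower reflect_rowsK ?behead_partition // -sum_t [X in X - _]sumn_behead addnK.
by case: t pt {sum_t inter} => // x t; apply: drop_zeros_partition_id.
Qed.

Lemma hstrip_local_rule :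
  count (fun s => [&& hstrip nu s, hstrip ka s & sumn ka <= sumn s + a])
        (partitions_upto (sumn nu)) =
  count (fun t => hstrip t nu && hstrip t ka) (partitions (sumn nu + a)).
Proof.
rewrite -!size_filter; set lows := filter _ _; set highs := filter _ _.
have lowsP s : reflect (below s) (s \in lows).
  rewrite mem_filter mem_partitions_upto [hstrip _ _ && _]andbA.
  apply: (iffP andP) => [[/andP[/hstrip_belowP ? ?] /andP[]] //|[ps inter ->]].
  have strips := introT (hstrip_belowP s) inter.
  by rewrite strips ps; case/andP: strips => /hstrip_sumn.
have highsP t : reflect (above t) (t \in highs).
  rewrite mem_filter mem_partitions.
  apply: (iffP andP) => [[/hstrip_aboveP[? ?] /andP[? /eqP]] //|[pt sum_t inter le0]].
  by rewrite pt sum_t eqxx; split=> //; apply/hstrip_aboveP.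
apply/eqP; rewrite eqn_leq; apply/andP; split.
  apply: (@leq_size_can _ _ _ _ raise lower) => [|s /lowsP low_s|s /lowsP low_s].
  - by rewrite filter_uniq ?partitions_upto_uniq.
  - exact/highsP/raise_above.
  - exact: raiseK.
apply: (@leq_size_can _ _ _ _ lower raise) => [|t /highsP high_t|t /highsP high_t].
- by rewrite filter_uniq ?partitions_uniq.
- exact/lowsP/lower_below.
- exact: lowerK.
Qed.

End LocalRule.

Local Open Scope ring_scope.

Lemma eq_big_seq_cond (R : Type) (idx : R) (op : R -> R -> R) (I : eqType) (r : seq I)
    (P : pred I) (F G : I -> R) :
  (forall i, i \in r -> P i -> F i = G i) ->
  \big[op/idx]_(i <- r | P i) F i = \big[op/idx]_(i <- r | P i) G i.
Proof.
move=> eqFG; rewrite big_seq_cond [RHS]big_seq_cond.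
by apply: eq_bigr => i /andP[]; apply: eqFG.
Qed.

Section SchurPolynomials.
Variables (R : comPzSemiRingType) (x : nat -> R).

(* The branching rule: [ka] is the shape formed by the entries below [n']. *)
Fixpoint schur_poly (n : nat) (nu : seq nat) : R :=
  if n is n'.+1 then
    \sum_(ka <- partitions_upto (sumn nu) | hstrip nu ka)
       x n' ^+ (sumn nu - sumn ka) * schur_poly n' ka
  else (nu == [::])%:R.

Fixpoint complete_poly (n a : nat) : R :=
  if n is n'.+1 then \sum_(i < a.+1) x n' ^+ (a - i) * complete_poly n' i else (a == 0%N)%:R.

Lemma complete_polyS n a :
  complete_poly n.+1 a.+1 = complete_poly n a.+1 + x n * complete_poly n.+1 a.
Proof.
rewrite /= big_ord_recr /= subnn mul1r addrC; congr (_ + _).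
rewrite mulr_sumr; apply: eq_bigr => i _; rewrite mulrA -exprS; congr (_ ^+ _ * _).
by have := ltn_ord i; lia.
Qed.

Lemma complete_poly0 n : complete_poly n 0 = 1.
Proof. by elim: n => [|n IHn] //=; rewrite big_ord1 IHn mulr1. Qed.

Lemma schur_poly_nil n : schur_poly n [::] = 1.
Proof.
elim: n => [|n IHn] //=; rewrite big_mkcond (perm_big [:: [::]]) /=.
  by rewrite big_seq1 IHn mulr1.
apply: uniq_perm => // [|s]; first exact: partitions_upto_uniq.
rewrite mem_partitions_upto inE leqn0; apply/andP/eqP => [[ps]|-> //].
by rewrite partition_sumn0 // => /eqP.
Qed.

Lemma pieri_no_variable a nu : is_partition nu ->
  complete_poly 0 a * schur_poly 0 nu =
  \sum_(t <- partitions (sumn nu + a) | hstrip t nu) schur_poly 0 t.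
Proof.
move=> pn /=; rewrite -natrM mulnb.
case: (posnP (sumn nu + a)%N) => [sum0|sum_gt0].
  have /eqP a0 : a == 0%N by lia.
  have /eqP -> : nu == [::] by rewrite -partition_sumn0 //; lia.
  by rewrite a0 partitions0 big_cons big_nil addr0.
rewrite big1_seq => [|t /andP[_]]; last first.
  by rewrite mem_partitions => /andP[pt /eqP sum_t]; rewrite -partition_sumn0 // sum_t gtn_eqF.
by rewrite -partition_sumn0 //; case: eqP => //; case: eqP => //; lia.
Qed.

Lemma pieri_branch n a M s : (sumn s + a <= M)%N ->
  (forall i, complete_poly n i * schur_poly n s =
     \sum_(t <- partitions (sumn s + i) | hstrip t s) schur_poly n t) ->
  \sum_(i < a.+1) x n ^+ (M - (sumn s + i)) * (complete_poly n i * schur_poly n s) =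
  \sum_(t <- partitions_upto M | hstrip t s && (sumn t <= sumn s + a)%N)
     x n ^+ (M - sumn t) * schur_poly n t.
Proof.
move=> le_M pieri_s.
transitivity (\sum_(i < a.+1) \sum_(t <- partitions_upto M | hstrip t s)
   if (sumn t == sumn s + i)%N then x n ^+ (M - sumn t) * schur_poly n t else 0).
  apply: eq_bigr => i _; have le_iM : (sumn s + i <= M)%N by have := ltn_ord i; lia.
  rewrite -big_mkcondr pieri_s (perm_big _ (perm_partitions le_iM)) /= big_filter_cond mulr_sumr.
  by apply: eq_big => [t|t /andP[/eqP -> _]]; rewrite // andbC.
rewrite exchange_big /= [RHS]big_mkcondr /=; apply: eq_bigr => t strip_t.
have le_st := hstrip_sumn strip_t; case: leqP => [le_t|lt_t].
  have lt_i : (sumn t - sumn s < a.+1)%N by lia.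
  rewrite (bigD1 (Ordinal lt_i)) //= subnKC // eqxx big1 ?addr0 // => i ne_i.
  by case: eqP => // t_i; case/eqP: ne_i; apply: val_inj => /=; lia.
by rewrite big1 // => i _; case: eqP => // t_i; have := ltn_ord i; lia.
Qed.

Lemma pieri n a nu : is_partition nu ->
  complete_poly n a * schur_poly n nu =
  \sum_(t <- partitions (sumn nu + a) | hstrip t nu) schur_poly n t.
Proof.
elim: n a nu => [|n IHn] a nu pn; first exact: pieri_no_variable.
set M := (sumn nu + a)%N.
transitivity (\sum_(s <- partitions_upto (sumn nu) | hstrip nu s)
   \sum_(ka <- partitions_upto M | hstrip ka s && (sumn ka <= sumn s + a)%N)
     x n ^+ (M - sumn ka) * schur_poly n ka).
  rewrite /= mulr_sumr; apply: eq_big_seq_cond => s.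
  rewrite mem_partitions_upto => /andP[ps le_s] strip_s.
  rewrite -pieri_branch => [|| i]; [|by rewrite /M; lia|exact: IHn].
  rewrite mulr_suml; apply: eq_bigr => i _; rewrite mulrACA -exprD; congr (_ ^+ _ * _).
  by rewrite /M; have := ltn_ord i; lia.
transitivity (\sum_(t <- partitions M | hstrip t nu)
   \sum_(ka <- partitions_upto M | hstrip t ka) x n ^+ (M - sumn ka) * schur_poly n ka).
  rewrite (exchange_big_dep predT) //= [RHS](exchange_big_dep predT) //=.
  apply: eq_big_seq => ka; rewrite mem_partitions_upto => /andP[pk _].
  by rewrite !big_const_seq (hstrip_local_rule pn pk).
by apply: eq_big_seq_cond => t; rewrite mem_partitions => /andP[_ /eqP /= ->].
Qed.

End SchurPolynomials.

Local Close Scope ring_scope.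

(** * Semistandard fillings *)

Lemma mem_diagram lam mu i j :
  ((i, j) \in diagram lam mu) = (0 < i) && (part mu i < j <= part lam i).
Proof.
apply/allpairsPdep/andP => [[i' [j' [mem_i mem_j [-> ->]]]]|[i_gt0 mem_j]].
  by move: mem_i mem_j; rewrite !mem_iota; lia.
exists i, j; split=> //; rewrite mem_iota; last by lia.
rewrite i_gt0 /= add1n ltnS leqNgt; apply/negP => lt_i.
by move: mem_j; rewrite /part (nth_default 0 (_ : size lam <= i.-1)); lia.
Qed.

Lemma mem_diagram_straight s i j : ((i.+1, j.+1) \in diagram s [::]) = (j < s`_i).
Proof. by rewrite mem_diagram /part nth_nil. Qed.

Lemma diagram_cellS lam mu c : c \in diagram lam mu -> exists i j, c = (i.+1, j.+1).
Proof. by case: c => -[|i] [|j]; rewrite mem_diagram // ?andbF // => _; exists i, j. Qed.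

Lemma diagram_uniq lam mu : uniq (diagram lam mu).
Proof.
by apply: allpairs_uniq_dep => [|i _|]; rewrite ?iota_uniq // => -[i j] [i' j'] _ _ [-> ->].
Qed.

Lemma size_diagram lam mu :
  size (diagram lam mu) = sumn [seq part lam i - part mu i | i <- iota 1 (size lam)].
Proof.
by rewrite size_allpairs_dep; congr (sumn _); apply: eq_map => i; apply: size_iota.
Qed.

Lemma size_diagram_straight nu : size (diagram nu [::]) = sumn nu.
Proof.
rewrite size_diagram; congr (sumn _); apply: (@eq_from_nth _ 0) => [|i].
  by rewrite size_map size_iota.
rewrite size_map size_iota => lt_i.
by rewrite (nth_map 0) ?size_iota // nth_iota // /part nth_nil subn0.
Qed.

Lemma diagram_straight_inj ka ka' : is_partition ka -> is_partition ka' ->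
  diagram ka [::] =i diagram ka' [::] -> ka = ka'.
Proof.
move=> pk pk' eq_diag; apply: partition_ext => // i.
have mem_row j : (j < ka`_i) = (j < ka'`_i) by rewrite -!mem_diagram_straight.
by have := mem_row ka`_i; have := mem_row ka'`_i; rewrite !ltnn; lia.
Qed.

Definition semistandard (D : seq (nat * nat)) (g : nat * nat -> nat) : Prop :=
  (forall i j j' : nat, (i, j) \in D -> (i, j') \in D -> j < j' -> g (i, j) <= g (i, j')) /\
  (forall i i' j : nat, (i, j) \in D -> (i', j) \in D -> i < i' -> g (i, j) < g (i', j)).

Lemma semistandard_sub (D E : seq (nat * nat)) g h :
  {subset E <= D} -> {in E, g =1 h} -> semistandard D g -> semistandard E h.
Proof.
move=> sub_ED eq_gh [row_g col_g].
by split=> [i j j'|i i' j] E1 E2 lt; rewrite -!eq_gh //; [apply: row_g | apply: col_g]; auto.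
Qed.

Section Filling.
Variables (D : seq (nat * nat)) (n : nat).
Implicit Type T : {ffun seq_sub D -> 'I_n}.

Definition filling T (c : nat * nat) : nat := if insub c is Some y then val (T y) else 0.

Lemma filling_val T y : filling T (val y) = T y.
Proof.
by rewrite /filling insubT ?(valP y) // => Dy; congr (val (T _)); apply: val_inj.
Qed.

Lemma ltn_filling T : {in D, forall c, filling T c < n}.
Proof. by move=> c Dc; have -> : c = val (SeqSub Dc) by []; rewrite filling_val. Qed.

Lemma eq_filling T T' : {in D, filling T =1 filling T'} -> T = T'.
Proof.
move=> eqT; apply/ffunP => y; apply: val_inj.
by rewrite /= -!filling_val; apply: eqT; apply: valP.
Qed.

Definition tableau_of g (g_lt : {in D, forall c, g c < n}) : {ffun seq_sub D -> 'I_n} :=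
  [ffun y => Ordinal (g_lt (val y) (valP y))].

Lemma filling_tableau_of g g_lt : {in D, filling (@tableau_of g g_lt) =1 g}.
Proof.
by move=> c Dc; have {1}-> : c = val (SeqSub Dc) by []; rewrite filling_val ffunE.
Qed.

Lemma is_ssytP T : reflect (semistandard D (filling T)) (is_ssyt T).
Proof.
apply: (iffP forallP) => [ssT|[row_T col_T] y].
  have ssT' c c' : c \in D -> c' \in D ->
      (c.1 = c'.1 -> c.2 < c'.2 -> filling T c <= filling T c') /\
      (c.2 = c'.2 -> c.1 < c'.1 -> filling T c < filling T c').
    move=> Dc Dc'; have /forallP/(_ (SeqSub Dc'))/andP[/= row col] := ssT (SeqSub Dc).
    rewrite (filling_val T (SeqSub Dc)) (filling_val T (SeqSub Dc')).
    by split=> eq_c lt_c; [move: row | move: col]; rewrite eq_c eqxx lt_c.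
  by split=> [i j j'|i i' j] Dc Dc' lt; have [row col] := ssT' _ _ Dc Dc';
     [apply: row | apply: col].
apply/forallP => y'; rewrite -!filling_val.
case: (val y) (val y') (valP y) (valP y') => [i j] [i' j'] /= Dc Dc'.
by apply/andP; split; apply/implyP => /andP[/eqP eq_c lt_c]; subst; [apply: row_T | apply: col_T].
Qed.

End Filling.

Local Open Scope ring_scope.

Lemma big_seq_sub (R : Type) (idx : R) (op : Monoid.com_law idx) (T : choiceType)
    (D : seq T) (f : T -> R) : uniq D ->
  \big[op/idx]_(y : seq_sub D) f (val y) = \big[op/idx]_(c <- D) f c.
Proof.
move=> D_uniq; rewrite -(big_map val predT f); apply: perm_big; apply: uniq_perm => // [|c].
  by rewrite map_inj_uniq ?index_enum_uniq //; apply: val_inj.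
apply/mapP/idP => [[y _ ->]|Dc]; first exact: valP.
by exists (SeqSub Dc); rewrite ?mem_index_enum.
Qed.

(** * Schur polynomials by branching *)

Section Branching.
Variable n : nat.

(* The variables of [{mpoly int[n]}] indexed by [nat]; those with index at least [n] are [0]. *)
Definition var_at (i : nat) : {mpoly int[n]} := if insub i is Some o then 'X_(o : 'I_n) else 0.

Lemma var_at_ord (o : 'I_n) : var_at o = 'X_o.
Proof. by rewrite /var_at insubT //= => lt_o; congr ('X_ _); apply: val_inj. Qed.

Lemma prod_filling (D : seq (nat * nat)) (T : {ffun seq_sub D -> 'I_n}) : uniq D ->
  \prod_y 'X_(T y) = \prod_(c <- D) var_at (filling T c) :> {mpoly int[n]}.
Proof.
move=> D_uniq; rewrite -(big_seq_sub _ (fun c => var_at (filling T c))) //; apply: eq_bigr => y _.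
by rewrite filling_val var_at_ord.
Qed.

Definition bounded (m : nat) (D : seq (nat * nat)) (g : nat * nat -> nat) :=
  all (fun c => g c < m)%N D.

Definition initial_shape (m : nat) (D : seq (nat * nat)) (g : nat * nat -> nat) (ka : seq nat) :=
  all (fun c => (g c < m)%N == (c \in diagram ka [::])) D.

Section InitialShape.
Variables (m : nat) (nu : seq nat).
Hypothesis nu_part : is_partition nu.
Notation D := (diagram nu [::]).

Lemma diagram_hstrip_sub ka : hstrip nu ka -> {subset diagram ka [::] <= D}.
Proof.
move=> /hstripP strip c Ec; have [i [j eq_c]] := diagram_cellS Ec; move: Ec.
by rewrite eq_c !mem_diagram_straight; have := strip i; lia.
Qed.

Lemma initial_shape_exists g : semistandard D g -> bounded m.+1 D g ->
  exists ka, [/\ is_partition ka, hstrip nu ka & initial_shape m D g ka].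
Proof.
move=> [row_g col_g] /allP g_le.
pose small i := find (fun j => m <= g (i.+1, j.+1))%N (iota 0 nu`_i).
have small_le i : (small i <= nu`_i)%N by rewrite -[leqRHS](size_iota 0) find_size.
have smallP i j : (j < nu`_i)%N -> (g (i.+1, j.+1) < m)%N = (j < small i)%N.
  move=> lt_j; case: (ltnP j (small i)) => [lt_j_small|le_small_j].
    by have := before_find 0%N lt_j_small; rewrite nth_iota // => /negbT; rewrite -ltnNge.
  have lt_small := leq_ltn_trans le_small_j lt_j; apply/negbTE; rewrite -leqNgt.
  have : has (fun j => m <= g (i.+1, j.+1))%N (iota 0 nu`_i) by rewrite has_find size_iota.
  move/(nth_find 0%N); rewrite nth_iota // add0n => /leq_trans; apply.
  move: le_small_j; rewrite leq_eqVlt => /predU1P[<- //|lt_small_j].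
  by apply: row_g; rewrite ?mem_diagram_straight.
have small_ge i : (nu`_i.+1 <= small i)%N.
  rewrite leqNgt; apply/negP => lt_small; have := partition_nonincreasing nu_part i.
  move/(leq_trans lt_small) => lt_small'; have := smallP _ _ lt_small'; rewrite ltnn.
  have mem1 : (i.+2, (small i).+1) \in D by rewrite mem_diagram_straight.
  have mem0 : (i.+1, (small i).+1) \in D by rewrite mem_diagram_straight.
  by have := col_g _ _ _ mem0 mem1 (ltnSn _); have := g_le _ mem1; lia.
have small_dec : nonincreasing small by move=> i; apply: leq_trans (small_le _) (small_ge _).
have small_size : small (size nu) = 0%N.
  by apply/eqP; rewrite -leqn0 -(nth_default 0%N (leqnn (size nu))).
exists (partition_of small (size nu)); split; first exact: partition_of_partition.
  by apply/hstripP => i; rewrite nth_partition_of // small_ge small_le.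
apply/allP => c Dc; have [i [j eq_c]] := diagram_cellS Dc; move: Dc.
by rewrite eq_c !mem_diagram_straight nth_partition_of // => /smallP ->.
Qed.

Lemma initial_shape_unique g ka ka' : is_partition ka -> is_partition ka' ->
  hstrip nu ka -> hstrip nu ka' -> initial_shape m D g ka -> initial_shape m D g ka' -> ka = ka'.
Proof.
move=> pk pk' strip strip' /allP shape /allP shape'; apply: diagram_straight_inj => // c.
case: (boolP (c \in D)) => [Dc|]; first by rewrite -(eqP (shape c Dc)) (eqP (shape' c Dc)).
by move=> nDc; rewrite !(contraNF (diagram_hstrip_sub _ (x := c)) nDc).
Qed.

Lemma sum_initial_shape (V : nmodType) (F : {ffun seq_sub D -> 'I_n} -> V) :
  \sum_(T | is_ssyt T && bounded m.+1 D (filling T)) F T =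
  \sum_(ka <- partitions_upto (sumn nu) | hstrip nu ka)
    \sum_(T | [&& is_ssyt T, bounded m.+1 D (filling T) & initial_shape m D (filling T) ka]) F T.
Proof.
under [RHS]eq_bigr => ka _ do under eq_bigl => T do rewrite andbA.
under [RHS]eq_bigr => ka _ do rewrite big_mkcondr /=.
rewrite exchange_big /=; apply: eq_bigr => T /andP[/is_ssytP ssT T_bounded].
have [ka [pk strip shape]] := initial_shape_exists ssT T_bounded.
have mem_ka : ka \in partitions_upto (sumn nu) by rewrite mem_partitions_upto pk hstrip_sumn.
rewrite [RHS]big_mkcond [RHS](bigD1_seq ka) ?partitions_upto_uniq //= strip shape.
rewrite big1_seq ?addr0 // => ka' /andP[ne_ka]; rewrite mem_partitions_upto => /andP[pk' _].
case: ifP => // strip'; case: ifP => // shape'; case/eqP: ne_ka.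
exact: (initial_shape_unique (g := filling T)).
Qed.

Section Extension.
Variable ka : seq nat.
Hypotheses (m_lt_n : (m < n)%N) (strip : hstrip nu ka).
Notation E := (diagram ka [::]).

Let sub_ED : {subset E <= D} := diagram_hstrip_sub strip.

Definition extension (g : nat * nat -> nat) c := if c \in E then g c else m.

Lemma semistandard_extension g : semistandard E g -> bounded m E g -> semistandard D (extension g).
Proof.
move=> [row_g col_g] /allP g_lt.
have E_left i j j' : (i, j) \in D -> (j < j')%N -> (i, j') \in E -> (i, j) \in E.
  by rewrite !mem_diagram; lia.
have E_above i i' j : (i, j) \in D -> (i', j) \in D -> (i < i')%N -> (i, j) \in E.
  move=> /diagram_cellS[i0 [j0 [-> ->]]]; case: i' => // i'.
  rewrite !mem_diagram_straight => lt_j lt_i.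
  have /hstripP/(_ i0)/andP[le_ka _] := strip.
  by apply: leq_trans le_ka; apply: leq_trans lt_j _; apply: partition_nth_leq.
rewrite /extension; split=> [i j j' Dj Dj' lt_j|i i' j Di Di' lt_i].
  case: (boolP ((i, j') \in E)) => [Ej'|_]; last by case: ifP => // /g_lt/ltnW.
  by rewrite (E_left i j j') //; apply: row_g; rewrite ?(E_left i j j').
have Ei := E_above _ _ _ Di Di' lt_i; rewrite Ei.
by case: ifP => [Ei'|_]; [apply: col_g | apply: g_lt].
Qed.

Lemma prod_extension g :
  \prod_(c <- D) var_at (extension g c) =
  var_at m ^+ (sumn nu - sumn ka) * \prod_(c <- E) var_at (g c).
Proof.
have perm_D : perm_eq D ([seq c <- D | c \notin E] ++ E).
  apply: uniq_perm; rewrite ?diagram_uniq ?cat_uniq ?filter_uniq ?diagram_uniq //=.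
    by rewrite andbT; apply/hasPn => c Ec; rewrite mem_filter Ec.
  move=> c; rewrite mem_cat mem_filter.
  by case: (boolP (c \in E)) => [/sub_ED -> //|_]; rewrite orbF.
rewrite (perm_big _ perm_D) big_cat /=; congr (_ * _); last first.
  by apply: eq_big_seq => c Ec; rewrite /extension Ec.
rewrite big_filter (eq_bigr (fun=> var_at m)) => [|c /negbTE nEc]; last by rewrite /extension nEc.
rewrite -big_filter big_const_seq count_predT iter_mulr_1; congr (_ ^+ _).
by have := perm_size perm_D; rewrite size_cat !size_diagram_straight => ->; rewrite addnK.
Qed.

Let extension_lt (S : {ffun seq_sub E -> 'I_n}) : {in D, forall c, extension (filling S) c < n}%N.
Proof. by move=> c _; rewrite /extension; case: ifP => // /ltn_filling. Qed.

Let restriction_lt (T : {ffun seq_sub D -> 'I_n}) : {in E, forall c, filling T c < n}%N.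
Proof. by move=> c /sub_ED; apply: ltn_filling. Qed.

Definition extend S := tableau_of (extension_lt S).
Definition restrict T := tableau_of (restriction_lt T).

Lemma filling_extend S : {in D, filling (extend S) =1 extension (filling S)}.
Proof. exact: filling_tableau_of. Qed.

Lemma filling_extend_small S : {in E, filling (extend S) =1 filling S}.
Proof. by move=> c Ec; rewrite filling_extend ?sub_ED // /extension Ec. Qed.

Lemma filling_restrict T : {in E, filling (restrict T) =1 filling T}.
Proof. exact: filling_tableau_of. Qed.

Lemma extendK : cancel extend restrict.
Proof.
by move=> S; apply: eq_filling => c Ec; rewrite filling_restrict // filling_extend_small.
Qed.

Lemma restrictK T : bounded m.+1 D (filling T) -> initial_shape m D (filling T) ka ->
  extend (restrict T) = T.
Proof.
move=> /allP T_le /allP shape; apply: eq_filling => c Dc; rewrite filling_extend // /extension.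
have := T_le c Dc; have := shape c Dc; case: (boolP (c \in E)) => [Ec _ _|_].
  exact: filling_restrict.
by rewrite eqbF_neg -leqNgt ltnS => le_m ge_m; apply/eqP; rewrite eqn_leq le_m.
Qed.

Lemma extend_ssytE S :
  [&& is_ssyt (extend S), bounded m.+1 D (filling (extend S))
    & initial_shape m D (filling (extend S)) ka] =
  is_ssyt S && bounded m E (filling S).
Proof.
apply/and3P/andP => [[/is_ssytP ssS _ /allP shape]|[/is_ssytP ssS S_lt]].
  split; first by apply/is_ssytP; apply: semistandard_sub ssS => //; apply: filling_extend_small.
  apply/allP => c Ec; have := shape c (sub_ED Ec).
  by rewrite filling_extend_small // Ec => /eqP.
split; last first.
- apply/allP => c Dc; rewrite filling_extend // /extension; case: ifP => [/(allP S_lt) -> //|_].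
  by rewrite ltnn.
- apply/allP => c Dc; rewrite filling_extend // /extension; case: ifP => // /(allP S_lt).
  exact: leqW.
by apply/is_ssytP; apply: semistandard_sub (semistandard_extension ssS S_lt) => // c Dc;
   rewrite filling_extend.
Qed.

Lemma sum_ssyt_initial_shape :
  \sum_(T : {ffun seq_sub D -> 'I_n} |
      [&& is_ssyt T, bounded m.+1 D (filling T) & initial_shape m D (filling T) ka])
    \prod_y 'X_(T y) =
  var_at m ^+ (sumn nu - sumn ka) *
  \sum_(S : {ffun seq_sub E -> 'I_n} | is_ssyt S && bounded m E (filling S)) \prod_y 'X_(S y)
  :> {mpoly int[n]}.
Proof.
rewrite (reindex_onto extend restrict) => [|T /and3P[_ T_le shape]]; last exact: restrictK.
rewrite mulr_sumr; apply: eq_big => [S|S _]; first by rewrite extend_ssytE extendK eqxx andbT.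
rewrite !prod_filling ?diagram_uniq // -prod_extension.
by apply: eq_big_seq => c Dc; rewrite filling_extend.
Qed.

End Extension.
End InitialShape.

Lemma sum_bounded_ssyt m nu : (m <= n)%N -> is_partition nu ->
  \sum_(T : {ffun seq_sub (diagram nu [::]) -> 'I_n}
          | is_ssyt T && bounded m (diagram nu [::]) (filling T)) \prod_y 'X_(T y) =
  schur_poly var_at m nu.
Proof.
elim: m nu => [|m IHm] nu le_mn pn; last first.
  rewrite sum_initial_shape //=; apply: eq_big_seq_cond => ka.
  rewrite mem_partitions_upto => /andP[pk _] strip.
  by rewrite sum_ssyt_initial_shape // IHm // ltnW.
rewrite /=; case: eqP => [->|/eqP nu_neq0]; last first.
  have mem11 : (1, 1)%N \in diagram nu [::].
    by rewrite mem_diagram_straight partition_nth_gt0 // lt0n size_eq0.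
  by rewrite big_pred0 // => T; apply/andP => -[_ /allP/(_ _ mem11)].
have no_cell (y : seq_sub (diagram [::] [::])) : False by have := valP y.
rewrite (big_pred1 [ffun y => False_rect _ (no_cell y)]) => [|T].
  by rewrite big1 // => y; case: (no_cell y).
rewrite [RHS](_ : _ = true); last by apply/eqP/ffunP => y; case: (no_cell y).
by apply/andP; split=> //; apply/is_ssytP; split.
Qed.

Lemma schurE nu : is_partition nu -> schur n nu = schur_poly var_at n nu.
Proof.
move=> pn; rewrite -sum_bounded_ssyt // /schur /skew_schur; apply: eq_bigl => T.
by rewrite andb_idr // => _; apply/allP; apply: ltn_filling.
Qed.

End Branching.

Local Close Scope ring_scope.

(** * Ribbon tableaux as words *)

Variant adjacency := Weak | Strict | Free.

Definition adjacent_ok k (a b : nat) :=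
  match k with Weak => b <= a | Strict => a < b | Free => true end.

Fixpoint satisfies (c : seq adjacency) (s : seq nat) : bool :=
  if c is k :: c' then
    if s is a :: s' then (if s' is b :: _ then adjacent_ok k a b else true) && satisfies c' s'
    else true
  else true.

Lemma satisfies_weak m u : size u = m.+1 -> satisfies (nseq m Weak) u = sorted geq u.
Proof. by elim: m u => [|m IHm] [|a [|b u]] //= [size_u]; rewrite IHm //= size_u. Qed.

Lemma satisfies_weak_cat m k c u v : size u = m.+1 -> 0 < size v ->
  satisfies (nseq m Weak ++ k :: c) (u ++ v) =
  [&& sorted geq u, adjacent_ok k (last 0 u) (head 0 v) & satisfies c v].
Proof.
elim: m u => [|m IHm] [|a [|b u]] //= size_u v_gt0; first by case: v v_gt0.
by rewrite (IHm (b :: u)) //=; [rewrite andbA | case: size_u => ->].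
Qed.

Definition overlap_adjacency (b : bool) := if b then Strict else Free.

(* A ribbon is encoded by its rows [(a, b)] from top to bottom: [a] is the length of the
   row and [b] tells whether it overlaps the next one. *)
Fixpoint adjacencies (L : seq (nat * bool)) : seq adjacency :=
  if L is (a, b) :: L' then
    nseq a.-1 Weak ++ (if L' is [::] then [::] else overlap_adjacency b :: adjacencies L')
  else [::].

Lemma adjacencies_cons a b L : 0 < size L ->
  adjacencies ((a, b) :: L) = nseq a.-1 Weak ++ overlap_adjacency b :: adjacencies L.
Proof. by case: L. Qed.

Local Open Scope ring_scope.

Lemma sum_tuple_cons (V : nmodType) (T : finType) m (P : pred (m.+1.-tuple T))
    (F : m.+1.-tuple T -> V) :
  \sum_(t | P t) F t =
  \sum_(a : T) \sum_(t : m.-tuple T | P [tuple of a :: t]) F [tuple of a :: t].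
Proof.
rewrite pair_big_dep /= (reindex (fun p : T * m.-tuple T => [tuple of p.1 :: p.2])) //=.
exists (fun t : m.+1.-tuple T => (thead t, [tuple of behead t])) => [[a t] _|t _] /=.
  by congr (_, _); apply: val_inj.
by rewrite -tuple_eta.
Qed.

Section Words.
Variables (R : comPzSemiRingType) (x : nat -> R) (n : nat).

Fixpoint words_from (c : seq adjacency) (a : nat) : R :=
  if c is k :: c' then x a * \sum_(b < n | adjacent_ok k a b) words_from c' b else x a.

Definition words c := \sum_(a < n) words_from c a.

Definition ribbon_words L := if L is [::] then 1 else words (adjacencies L).

Lemma words_from_free_split c1 c2 a :
  words_from (c1 ++ Free :: c2) a =
  words_from (c1 ++ Weak :: c2) a + words_from (c1 ++ Strict :: c2) a.
Proof.
elim: c1 a => [|k c1 IHc] a /=; last first.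
  by rewrite -mulrDr -big_split /=; congr (_ * _); apply: eq_bigr => b _; apply: IHc.
rewrite -mulrDr (bigID (fun b : 'I_n => (b <= a)%N)) /=; congr (_ * (_ + _)).
by apply: eq_bigl => b; rewrite -ltnNge.
Qed.

Lemma words_free_split c1 c2 :
  words (c1 ++ Free :: c2) = words (c1 ++ Weak :: c2) + words (c1 ++ Strict :: c2).
Proof. by rewrite -big_split; apply: eq_bigr => a _; apply: words_from_free_split. Qed.

Lemma words_weak_free m c : words (nseq m Weak ++ Free :: c) = words (nseq m Weak) * words c.
Proof.
rewrite /words mulr_suml; apply: eq_bigr => a _; elim: m (a : nat) => [|m IHm] {}a //=.
by rewrite -mulrA mulr_suml; congr (_ * _); apply: eq_bigr => b _; apply: IHm.
Qed.

Lemma sum_complete_poly k m :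
  \sum_(a < k) x a * complete_poly x a.+1 m = complete_poly x k m.+1.
Proof.
elim: k => [|k IHk]; first by rewrite big_ord0.
by rewrite big_ord_recr [in LHS]/= IHk complete_polyS.
Qed.

Lemma words_from_weak m (a : nat) : (a < n)%N ->
  words_from (nseq m Weak) a = x a * complete_poly x a.+1 m.
Proof.
elim: m a => [|m IHm] a lt_an; first by rewrite complete_poly0 mulr1.
rewrite [LHS]/=; congr (_ * _); rewrite -sum_complete_poly.
rewrite (big_ord_widen_cond n (fun=> true) (fun b => x b * complete_poly x b.+1 m)) //.
by apply: eq_bigr => b _; apply: IHm.
Qed.

Lemma words_weak m : words (nseq m Weak) = complete_poly x n m.+1.
Proof. by rewrite -sum_complete_poly; apply: eq_bigr => a _; apply: words_from_weak. Qed.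

Lemma words_from_tuple c a :
  words_from c a =
  \sum_(t : (size c).-tuple 'I_n | satisfies c (a :: map val t)) x a * \prod_(i <- t) x (val i).
Proof.
elim: c a => [|k c IHc] a /=.
  rewrite (big_pred1 [tuple]) => [|t]; first by rewrite big_nil mulr1.
  by rewrite [t]tuple0 /= eqxx.
rewrite sum_tuple_cons mulr_sumr big_mkcond /=; apply: eq_bigr => b _.
case: ifP => ok_ab; last by rewrite big_pred0.
by rewrite IHc mulr_sumr /=; apply: eq_bigr => t _; rewrite big_cons.
Qed.

Lemma words_tuple c :
  words c = \sum_(t : (size c).+1.-tuple 'I_n | satisfies c (map val t)) \prod_(i <- t) x (val i).
Proof.
rewrite sum_tuple_cons; apply: eq_bigr => a _; rewrite words_from_tuple.
by apply: eq_bigr => t _; rewrite /= big_cons.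
Qed.

End Words.

Section Reading.
Variables (n : nat) (D E : seq (nat * nat)).
Hypotheses (D_uniq : uniq D) (E_uniq : uniq E) (eq_DE : D =i E).

Let mem_cell (k : 'I_(size E)) : tnth (in_tuple E) k \in D.
Proof. by rewrite eq_DE mem_tnth. Qed.

Definition cell (k : 'I_(size E)) : seq_sub D := SeqSub (mem_cell k).

Let cell_rank_lt (y : seq_sub D) : (index (val y) E < size E)%N.
Proof. by rewrite index_mem -eq_DE (valP y). Qed.

Definition cell_rank (y : seq_sub D) : 'I_(size E) := Ordinal (cell_rank_lt y).

Lemma cellK : cancel cell cell_rank.
Proof. by move=> k; apply: val_inj; rewrite /= (tnth_nth (0, 0)%N) /= index_uniq. Qed.

Lemma cell_rankK : cancel cell_rank cell.
Proof.
move=> y; apply: val_inj; rewrite /= (tnth_nth (0, 0)%N) /= nth_index //.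
by rewrite -eq_DE (valP y).
Qed.

Definition word (T : {ffun seq_sub D -> 'I_n}) : (size E).-tuple 'I_n :=
  [tuple T (cell k) | k < size E].

Lemma word_filling T : map val (word T) = map (filling T) E.
Proof.
transitivity (map (filling T \o tnth (in_tuple E)) (enum 'I_(size E))); last first.
  by rewrite map_comp map_tnth_enum.
by rewrite /= -map_comp; apply: eq_map => k; rewrite /= -(filling_val T (cell k)).
Qed.

Lemma word_bij : bijective word.
Proof.
exists (fun t => [ffun y => tnth t (cell_rank y)]) => [T|t].
  by apply/ffunP => y; rewrite ffunE tnth_mktuple cell_rankK.
by apply: eq_from_tnth => k; rewrite tnth_mktuple ffunE cellK.
Qed.

Lemma sum_filling_word (P : pred {ffun seq_sub D -> 'I_n}) (Q : pred (seq nat)) :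
  (forall T, P T = Q (map (filling T) E)) ->
  \sum_(T | P T) \prod_y 'X_(T y) =
  \sum_(t : (size E).-tuple 'I_n | Q (map val t)) \prod_(i <- t) var_at n (val i)
  :> {mpoly int[n]}.
Proof.
move=> PQ; rewrite [RHS](reindex word) /=; last exact: onW_bij word_bij.
apply: eq_big => [T|T _]; first by rewrite PQ -word_filling.
rewrite prod_filling // -(big_map val predT (var_at n)) word_filling big_map.
by apply: perm_big; apply: uniq_perm.
Qed.

End Reading.

Local Close Scope ring_scope.

Definition ribbon_ge2 (lam mu : seq nat) : Prop :=
  [/\ is_partition lam, is_partition mu,
      forall i, 1 <= i <= size lam -> part mu i + 2 <= part lam i &
      forall i, 1 <= i -> part lam i.+1 <= (part mu i).+1].

Lemma leq_part s i j : is_partition s -> 0 < i -> i <= j -> part s j <= part s i.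
Proof. by move=> ps i_gt0 le_ij; apply: partition_nth_leq => //; lia. Qed.

Lemma part_gt_size s i : size s < i -> part s i = 0.
Proof. by move=> lt_i; rewrite /part nth_default //; lia. Qed.

Lemma is_ribbon_ge2 alpha lam mu :
  is_ribbon alpha lam mu -> all (fun a => 2 <= a) alpha -> ribbon_ge2 lam mu.
Proof.
move=> [[lam_part mu_part _] no_square alphaE _ _] alpha_ge2; split=> // i.
  move=> i_row; have : part lam i - part mu i \in alpha.
    by rewrite alphaE; apply: map_f; rewrite mem_iota; lia.
  by move/(allP alpha_ge2) => /=; lia.
move=> i_gt0; rewrite leqNgt; apply/negP => gt.
have lam_le := leq_part lam_part i_gt0 (leqnSn i).
have mu_le := leq_part mu_part i_gt0 (leqnSn i).
by apply: (no_square i (part mu i).+1); split; rewrite mem_diagram; lia.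
Qed.

Section RibbonReading.
Variables lam mu : seq nat.
Hypothesis ribbon : ribbon_ge2 lam mu.
Notation l := (size lam).

Let lam_part : is_partition lam. Proof. by case: ribbon. Qed.

Let row_ge2 i : 1 <= i <= l -> part mu i + 2 <= part lam i.
Proof. by case: ribbon => _ _ + _; apply. Qed.

Let row_next i : 1 <= i -> part lam i.+1 <= (part mu i).+1.
Proof. by case: ribbon => _ _ _; apply. Qed.

Definition overlap i := part mu i < part lam i.+1.

Definition row_cells r :=
  [seq (r, j) | j <- rev (iota (part mu r).+1 (part lam r - part mu r))].

Definition reading i k := flatten [seq row_cells r | r <- iota i k].

Definition ribbon_rows i k := [seq (part lam r - part mu r, overlap r) | r <- iota i k].

Lemma mem_reading i k c :
  (c \in reading i k) = (i <= c.1 < i + k) && (part mu c.1 < c.2 <= part lam c.1).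
Proof.
apply/flatten_mapP/andP => [[r]|[c_row c_col]].
  by rewrite mem_iota => r_row /mapP[j]; rewrite mem_rev mem_iota => j_col -> /=; lia.
exists c.1; rewrite ?mem_iota //; apply/mapP; exists c.2; last by case: (c).
by rewrite mem_rev mem_iota; lia.
Qed.

Lemma reading_uniq i k : uniq (reading i k).
Proof.
elim: k i => [|k IHk] i //; rewrite /reading /= cat_uniq -/(reading i.+1 k) IHk andbT.
rewrite map_inj_uniq ?rev_uniq ?iota_uniq //=; last by move=> ? ? [].
apply/hasPn => c; rewrite mem_reading => c_below; apply/negP => /mapP[j _ eq_c].
by move: c_below; rewrite eq_c /=; lia.
Qed.

Lemma diagram_reading : diagram lam mu =i reading 1 l.
Proof.
move=> [i j]; rewrite mem_diagram mem_reading /=; case: (leqP i l) => [le_il|lt_li].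
  by rewrite add1n ltnS le_il andbT.
by rewrite (part_gt_size lt_li); lia.
Qed.

Section ReadingWord.
Variable g : nat * nat -> nat.

Lemma size_row_word r : 1 <= r <= l ->
  size (map g (row_cells r)) = (part lam r - part mu r).-1.+1.
Proof. by move/row_ge2; rewrite !size_map size_rev size_iota; lia. Qed.

Lemma nth_row_word r k : k < part lam r - part mu r ->
  (map g (row_cells r))`_k = g (r, part lam r - k).
Proof.
move=> lt_k; rewrite -map_comp (nth_map 0) ?size_rev ?size_iota //.
by rewrite nth_rev size_iota // nth_iota /=; [congr (g (_, _)) |]; lia.
Qed.

Lemma head_row_word r : 1 <= r <= l -> head 0 (map g (row_cells r)) = g (r, part lam r).
Proof. by move/row_ge2 => ge2; rewrite -nth0 nth_row_word ?subn0 //; lia. Qed.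

Lemma last_row_word r : 1 <= r <= l -> last 0 (map g (row_cells r)) = g (r, (part mu r).+1).
Proof.
move=> r_row; have ge2 := row_ge2 r_row; rewrite -nth_last size_row_word // nth_row_word; last lia.
by congr (g (_, _)); lia.
Qed.

Lemma row_sortedP r : reflect
  (forall j j', part mu r < j -> j < j' -> j' <= part lam r -> g (r, j) <= g (r, j'))
  (sorted geq (map g (row_cells r))).
Proof.
apply: (iffP (sorted_geqP _)) => [row_dec j j' mu_j lt_j j'_lam|row_g k].
  have := nonincreasing_leq (i := part lam r - j') (j := part lam r - j) row_dec.
  by rewrite !nth_row_word ?subKn; lia.
case: (ltnP k.+1 (part lam r - part mu r)) => [lt_k|le_k]; last first.
  by rewrite nth_default // !size_map size_rev size_iota.
by rewrite !nth_row_word; try lia; apply: row_g; lia.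
Qed.

Definition overlap_increases r := overlap r ==> (g (r, (part mu r).+1) < g (r.+1, part lam r.+1)).

Lemma satisfies_reading i k : 1 <= i -> i + k <= l.+1 ->
  satisfies (adjacencies (ribbon_rows i k)) (map g (reading i k)) =
  all (fun r => sorted geq (map g (row_cells r))) (iota i k) &&
  all overlap_increases (iota i k.-1).
Proof.
elim: k i => [|[|k] IHk] i i_gt0 le_ik //.
  rewrite /ribbon_rows /reading /= !cats0 !andbT.
  by rewrite satisfies_weak // size_row_word; lia.
have rowsE :
  ribbon_rows i k.+2 = (part lam i - part mu i, overlap i) :: ribbon_rows i.+1 k.+1 by [].
have readingE : map g (reading i k.+2) = map g (row_cells i) ++ map g (reading i.+1 k.+1).
  by rewrite -map_cat.
have next_head : head 0 (map g (reading i.+1 k.+1)) = g (i.+1, part lam i.+1).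
  rewrite /reading /= map_cat -head_row_word; last lia.
  by case: (map g (row_cells i.+1)) (@size_row_word i.+1) => //= /(_ ltac:(lia)).
rewrite rowsE readingE adjacencies_cons // satisfies_weak_cat; first last.
- by rewrite size_map size_flatten /= size_map size_rev size_iota; have := @row_ge2 i.+1; lia.
- by rewrite size_row_word; lia.
rewrite next_head last_row_word ?IHk; try lia.
have -> : adjacent_ok (overlap_adjacency (overlap i)) (g (i, (part mu i).+1))
    (g (i.+1, part lam i.+1)) = overlap_increases i.
  by rewrite /overlap_increases; case: (overlap i).
by rewrite andbA andbACA.
Qed.

Lemma semistandard_ribbonP :
  reflect (semistandard (diagram lam mu) g)
    (all (fun r => sorted geq (map g (row_cells r))) (iota 1 l) &&
     all overlap_increases (iota 1 l.-1)).
Proof.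
apply: (iffP andP) => [[/allP rows_sorted /allP increases]|[row_g col_g]]; last first.
  split; apply/allP => r; rewrite mem_iota => r_row.
    by apply/row_sortedP => j j' ? ? ?; apply: row_g; rewrite ?mem_diagram; lia.
  apply/implyP => over; have next := @row_next r.
  have -> : part lam r.+1 = (part mu r).+1 by rewrite /overlap in over; lia.
  have ge2 := @row_ge2 r; have ge2' := @row_ge2 r.+1; rewrite /overlap in over.
  by apply: col_g; rewrite ?mem_diagram; lia.
have row_le r j : part mu r < j <= part lam r -> r <= l.
  by case: (leqP r l) => // /part_gt_size ->; lia.
split=> [r j j'|r r' j]; rewrite !mem_diagram => /andP[r_gt0 col_j] /andP[r'_gt0 col_j'] lt.
  have := row_le _ _ col_j => le_rl.
  have /row_sortedP : sorted geq (map g (row_cells r)) by apply: rows_sorted; rewrite mem_iota; lia.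
  by apply; lia.
have le_r'l := row_le _ _ col_j'; have next := @row_next r; have ge2 := @row_ge2 r.+1.
have next' := @row_next r.+1; have ge2' := @row_ge2 r.
have r'E : r' = r.+1.
  apply/eqP; rewrite eqn_leq lt andbT leqNgt; apply/negP => lt2.
  by have := leq_part lam_part (isT : 0 < r.+2) lt2; lia.
subst r'; have jE : j = (part mu r).+1 by lia.
have : overlap_increases r by apply: increases; rewrite mem_iota; lia.
have lamE : part lam r.+1 = (part mu r).+1 by lia.
by rewrite jE /overlap_increases /overlap lamE ltnSn.
Qed.

End ReadingWord.

Lemma size_adjacencies i k : 1 <= i -> i + k <= l.+1 -> 0 < k ->
  (size (adjacencies (ribbon_rows i k))).+1 = size (reading i k).
Proof.
elim: k i => [|[|k] IHk] i i_gt0 le_ik // _.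
  rewrite /ribbon_rows /reading /= !cats0 size_nseq size_map size_rev size_iota.
  by have := @row_ge2 i; lia.
have -> : size (reading i k.+2) = (part lam i - part mu i) + size (reading i.+1 k.+1).
  by rewrite /reading /= size_cat size_map size_rev size_iota.
rewrite -IHk; try lia.
have -> :
  ribbon_rows i k.+2 = (part lam i - part mu i, overlap i) :: ribbon_rows i.+1 k.+1 by [].
rewrite adjacencies_cons // size_cat size_nseq.
by set c := adjacencies _; have := @row_ge2 i; rewrite /=; lia.
Qed.

Lemma skew_schur_ribbon_words n :
  skew_schur n lam mu = ribbon_words (var_at n) n (ribbon_rows 1 l).
Proof.
rewrite /skew_schur (sum_filling_word (diagram_uniq lam mu) (reading_uniq 1 l) diagram_reading
  (Q := satisfies (adjacencies (ribbon_rows 1 l)))) => [|T]; last first.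
  by rewrite satisfies_reading //; apply/is_ssytP/semistandard_ribbonP.
case: (posnP l) => [l0|l_gt0].
  rewrite l0 /= (big_pred1 [tuple]) ?big_nil // => t.
  by rewrite [t]tuple0; apply/esym/eqP.
rewrite -size_adjacencies // -words_tuple.
have : 0 < size (ribbon_rows 1 l) by rewrite size_map size_iota.
by case: (ribbon_rows 1 l).
Qed.

End RibbonReading.

(** * Chains of horizontal strips *)

(* The strip [rho / nu] has a cell in a lower row than some cell of [nu / ka]: in
   the standardization of the chain, the last entry of [nu / ka] is a descent. *)
Definition descent (ka nu rho : seq nat) :=
  has (fun j => (nu`_j < rho`_j) && has (fun i => ka`_i < nu`_i) (iota 0 j)) (iota 0 (size rho)).

Lemma descentP ka nu rho :
  reflect (exists i j, [/\ i < j, ka`_i < nu`_i & nu`_j < rho`_j]) (descent ka nu rho).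
Proof.
apply: (iffP hasP) => [[j _ /andP[nu_rho /hasP[i]]]|[i [j [lt_ij ka_nu nu_rho]]]].
  by rewrite mem_iota => /andP[_ lt_ij] ka_nu; exists i, j.
exists j; last by rewrite nu_rho; apply/hasP; exists i; rewrite ?mem_iota.
rewrite mem_iota leq0n /= add0n ltnNge; apply: contraL nu_rho => le_j.
by rewrite -leqNgt (nth_default _ le_j).
Qed.

Lemma nondescent_leq ka nu rho i j :
  ~~ descent ka nu rho -> i < j -> ka`_i < nu`_i -> rho`_j <= nu`_j.
Proof.
move=> nodesc lt_ij ka_nu; rewrite leqNgt; apply: contra nodesc => nu_rho.
by apply/descentP; exists i, j.
Qed.

Definition strips (a : nat) (nu : seq nat) :=
  [seq ka <- partitions_upto (sumn nu) | hstrip nu ka & sumn nu == sumn ka + a].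

Lemma strips_uniq a nu : uniq (strips a nu).
Proof. by rewrite filter_uniq ?partitions_upto_uniq. Qed.

Lemma stripsP a nu ka :
  reflect [/\ is_partition ka, hstrip nu ka & sumn nu = sumn ka + a] (ka \in strips a nu).
Proof.
rewrite mem_filter mem_partitions_upto.
apply: (iffP andP) => [[/andP[? /eqP ?] /andP[]] //|[-> strip sum_nu]].
by rewrite strip sum_nu eqxx leq_addr.
Qed.

Lemma sum_strips_exchange (V : nmodType) s a (F : seq nat -> seq nat -> V) :
  (\sum_(ka <- partitions s) \sum_(nu <- partitions (s + a) | hstrip nu ka) F ka nu =
   \sum_(nu <- partitions (s + a)) \sum_(ka <- strips a nu) F ka nu)%R.
Proof.
rewrite (exchange_big_dep predT) //=; apply: eq_big_seq => nu.
rewrite mem_partitions => /andP[pn /eqP sum_nu]; rewrite -big_filter; apply: perm_big.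
apply: uniq_perm => [||ka]; rewrite ?(filter_uniq _ (partitions_uniq s)) ?strips_uniq //.
rewrite mem_filter mem_partitions; apply/and3P/stripsP => [[strip pk /eqP sum_ka]|[pk strip]].
  by split; rewrite // sum_nu sum_ka.
by rewrite sum_nu => /addIn ->.
Qed.

(* [pnu / nu] is the strip removed before; [pb] requires a descent between it and
   the next strip. *)
Fixpoint chain_count (L : seq (nat * bool)) (pb : bool) (pnu nu : seq nat) : nat :=
  if L is (a, b) :: L' then
    \sum_(ka <- strips a nu | pb ==> descent ka nu pnu) chain_count L' b nu ka
  else nu == [::].

Lemma chain_count_false L pnu nu : chain_count L false pnu nu = chain_count L false [::] nu.
Proof. by case: L => [|[a b] L]. Qed.

Lemma hstrip_proper_row nu ka : hstrip nu ka -> sumn ka < sumn nu -> exists k, ka`_k < nu`_k.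
Proof.
move=> /hstripP strip; case: (boolP [exists k : 'I_(size nu), ka`_k < nu`_k]).
  by case/existsP=> k lt_k _; exists k.
move/existsPn=> no_row; rewrite ltnNge => /negP[]; apply: leq_sumn_nth => k.
case: (ltnP k (size nu)) => [lt_k|le_k]; last by rewrite nth_default.
by rewrite leqNgt (no_row (Ordinal lt_k)).
Qed.

Lemma descent_merge_strip nu2 nu1 nu pnu :
  hstrip nu nu1 -> hstrip nu1 nu2 -> ~~ descent nu2 nu1 nu -> sumn nu1 < sumn nu ->
  descent nu1 nu pnu = descent nu2 nu pnu.
Proof.
move=> strip1 strip2 nodesc lt_sum; have [k lt_k] := hstrip_proper_row strip1 lt_sum.
move/hstripP: strip1 => strip1; move/hstripP: strip2 => strip2.
apply/descentP/descentP => -[i [j [lt_ij lt_i lt_j]]].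
  by exists i, j; split=> //; have := strip2 i; lia.
case: (ltnP nu1`_i nu`_i) => [lt1_i|ge1_i]; first by exists i, j.
exists k, j; split=> //; apply: leq_ltn_trans lt_ij; rewrite leqNgt; apply/negP => lt_ik.
by have := nondescent_leq nodesc lt_ik; lia.
Qed.

Lemma descent_merge_above nu3 nu2 nu1 nu :
  hstrip nu nu1 -> hstrip nu1 nu2 -> ~~ descent nu2 nu1 nu -> sumn nu2 < sumn nu1 ->
  descent nu3 nu2 nu1 = descent nu3 nu2 nu.
Proof.
move=> strip1 strip2 nodesc lt_sum; have [k lt_k] := hstrip_proper_row strip2 lt_sum.
move/hstripP: strip1 => strip1; move/hstripP: strip2 => strip2.
apply/descentP/descentP => -[i [j [lt_ij lt_i lt_j]]].
  by exists i, j; split=> //; have := strip1 j; lia.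
case: (ltnP nu2`_j nu1`_j) => [lt2_j|ge2_j]; first by exists i, j.
exists i, k; split=> //; apply: leq_trans lt_ij _; rewrite leqNgt; apply/negP => lt_kj.
by have := nondescent_leq nodesc lt_kj lt_k; lia.
Qed.

(* [e] units distributed over boxes of capacities [d 0], [d 1], ..., filling the
   first boxes first. *)
Definition topfill (d : nat -> nat) e i := minn (d i) (e - \sum_(j < i) d j).

Lemma sum_topfill d e k : \sum_(i < k) topfill d e i = minn e (\sum_(i < k) d i).
Proof.
elim: k => [|k IHk]; first by rewrite !big_ord0 minn0.
by rewrite !sum_ord_recr IHk /topfill; move: (\sum_(i < k) d i) => s; lia.
Qed.

Lemma leq_sum_prefix (f : nat -> nat) i k : i <= k -> \sum_(j < i) f j <= \sum_(j < k) f j.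
Proof.
move=> le_ik; rewrite (big_ord_widen k f le_ik) big_mkcond.
by apply: leq_sum => j _; case: ifP.
Qed.

(* Two successive strips without a descent form one strip, and they are recovered from
   it: the outer one consists of its topmost cells. *)
Section MergeStrips.
Variables nu nu2 : seq nat.

Let d i := nu`_i - nu2`_i.

Lemma nondescent_hstrip nu1 :
  hstrip nu nu1 -> hstrip nu1 nu2 -> ~~ descent nu2 nu1 nu -> hstrip nu nu2.
Proof.
move=> /hstripP strip1 /hstripP strip2 nodesc; apply/hstripP => i.
have := strip1 i; have := strip2 i; have := strip1 i.+1.
have := nondescent_leq nodesc (leqnn i.+1).
by case: (ltnP nu2`_i nu1`_i) => [_ /(_ isT)|]; lia.
Qed.

Lemma nondescent_prefix nu1 a k : hstrip nu nu1 -> hstrip nu1 nu2 -> ~~ descent nu2 nu1 nu ->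
  sumn nu = sumn nu1 + a -> \sum_(i < k) (nu`_i - nu1`_i) = minn a (\sum_(i < k) d i).
Proof.
move=> /hstripP strip1 /hstripP strip2 nodesc sum_nu.
pose n := k + (size nu + size nu1); have le_kn : k <= n by apply: leq_addr.
have total : \sum_(i < n) (nu`_i - nu1`_i) = a.
  rewrite sumnB => [|i _]; last by case/andP: (strip1 i).
  by rewrite !sum_nth_sumn ?sum_nu ?addKn // /n; lia.
have le_total := leq_sum_prefix (fun i => nu`_i - nu1`_i) le_kn; rewrite total in le_total.
have le_d : \sum_(i < k) (nu`_i - nu1`_i) <= \sum_(i < k) d i.
  by apply: leq_sum => i _; rewrite /d; have := strip2 i; lia.
case: (boolP [exists i : 'I_k, nu2`_i < nu1`_i]) => [/existsP[i lt_i]|/existsPn no_row].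
  suff : \sum_(i < k) (nu`_i - nu1`_i) = a by lia.
  rewrite -total (big_ord_widen n (fun i => nu`_i - nu1`_i) le_kn) big_mkcond.
  apply: eq_bigr => j _; case: ltnP => // le_kj.
  by have := nondescent_leq nodesc (leq_trans (ltn_ord i) le_kj) lt_i; lia.
suff : \sum_(i < k) (nu`_i - nu1`_i) = \sum_(i < k) d i by lia.
by apply: eq_bigr => i _; rewrite /d; have := no_row i; have := strip2 i; rewrite -leqNgt; lia.
Qed.

Lemma nondescent_row nu1 a i : hstrip nu nu1 -> hstrip nu1 nu2 -> ~~ descent nu2 nu1 nu ->
  sumn nu = sumn nu1 + a -> nu1`_i = nu`_i - topfill d a i.
Proof.
move=> strip1 strip2 nodesc sum_nu.
have := nondescent_prefix i strip1 strip2 nodesc sum_nu.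
have := nondescent_prefix i.+1 strip1 strip2 nodesc sum_nu.
rewrite -!sum_topfill !big_ord_recr /= => sumS sum_i.
by have /hstripP/(_ i) := strip1; lia.
Qed.

Hypotheses (nu_part : is_partition nu) (strip : hstrip nu nu2).

Let d_nu2 i : d i + nu2`_i = nu`_i.
Proof. by rewrite /d; have /hstripP/(_ i) := strip; lia. Qed.

Let topfill_d a i : topfill d a i <= d i. Proof. exact: geq_minl. Qed.

Lemma nondescent_exists a a' : sumn nu = sumn nu2 + a' + a ->
  exists nu1, [/\ nu1 \in strips a nu, hstrip nu1 nu2 & ~~ descent nu2 nu1 nu].
Proof.
move=> sum_nu; pose mid i := nu`_i - topfill d a i.
have /hstripP strip_i := strip.
have mid_dec : nonincreasing mid.
  by move=> i; rewrite /mid; have := topfill_d a i; have := strip_i i; have := d_nu2 i; lia.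
have mid_size : mid (size nu) = 0 by rewrite /mid nth_default.
have mid_row := nth_partition_of mid_dec mid_size.
exists (partition_of mid (size nu)); split; first apply/stripsP; first split.
- exact: partition_of_partition.
- apply/hstripP => i; rewrite mid_row /mid.
  by have := topfill_d a i; have := d_nu2 i; have := strip_i i; lia.
- rewrite sumn_partition_of //.
  have : \sum_(i < size nu) mid i + \sum_(i < size nu) topfill d a i = sumn nu.
    rewrite -(sum_nth_sumn (leqnn _)) -big_split /=; apply: eq_bigr => i _.
    by rewrite /mid; have := topfill_d a i; have := d_nu2 i; lia.
  have : \sum_(i < size nu) d i + \sum_(i < size nu) nu2`_i = sumn nu.
    by rewrite -(sum_nth_sumn (leqnn _)) -big_split /=; apply: eq_bigr => i _; rewrite d_nu2.
  by have := leq_sumn_take nu2 (size nu); rewrite sumn_take_sum sum_topfill; lia.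
- apply/hstripP => i; rewrite !mid_row /mid.
  have := topfill_d a i; have := d_nu2 i; have := strip_i i.
  by have := topfill_d a i.+1; have := d_nu2 i.+1; lia.
apply/descentP => -[i [j [lt_ij]]]; rewrite !mid_row /mid => lt_i lt_j.
have := leq_sum_prefix d lt_ij; have := d_nu2 i.
move: lt_i lt_j; rewrite sum_ord_recr /topfill.
by move: (\sum_(k < i) d k) (\sum_(k < j) d k) => s1 s2; lia.
Qed.

End MergeStrips.

Lemma perm_strips_merge a a' nu : is_partition nu ->
  perm_eq [seq nu2 | nu1 <- strips a nu, nu2 <- [seq nu2 <- strips a' nu1 | ~~ descent nu2 nu1 nu]]
          (strips (a + a') nu).
Proof.
move=> pn; apply: uniq_perm => [||nu2]; last 2 first.
- exact: strips_uniq.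
- apply/allpairsPdep/stripsP => [[nu1 [z []]]|[p2 strip sum_nu]].
    move=> /stripsP[_ strip1 sum1]; rewrite mem_filter => /andP[nodesc].
    move=> /stripsP[p2 strip2 sum2] ->.
    by split=> //; [apply: nondescent_hstrip strip1 strip2 nodesc | lia].
  have sum_nu' : sumn nu = sumn nu2 + a' + a by lia.
  have [nu1 [mem1 strip2 nodesc]] := nondescent_exists pn strip sum_nu'.
  exists nu1, nu2; split=> //; rewrite mem_filter nodesc; apply/stripsP; split=> //.
  by case/stripsP: mem1; lia.
apply: allpairs_uniq_dep => [|nu1 _|]; first exact: strips_uniq.
  exact/filter_uniq/strips_uniq.
move=> _ _ /allpairsPdep[x [y [mem_x mem_y ->]]] /allpairsPdep[x' [y' [mem_x' mem_y' ->]]] /= eq_y.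
move: mem_y; rewrite mem_filter => /andP[nodesc /stripsP[_ strip _]].
move: mem_y'; rewrite -eq_y mem_filter => /andP[nodesc' /stripsP[_ strip' _]].
case/stripsP: mem_x mem_x' => px strip_x sum_x /stripsP[px' strip_x' sum_x'].
suff -> : x = x' by [].
apply: partition_ext => // i.
rewrite (nondescent_row i strip_x strip nodesc sum_x).
by rewrite (nondescent_row i strip_x' strip' nodesc' sum_x').
Qed.

Lemma chain_count_merge a a' b L pb pnu nu : 0 < a -> 0 < a' -> is_partition nu ->
  chain_count ((a, false) :: (a', b) :: L) pb pnu nu =
  chain_count ((a + a', b) :: L) pb pnu nu + chain_count ((a, true) :: (a', b) :: L) pb pnu nu.
Proof.
move=> a_gt0 a'_gt0 pn /=.
under eq_bigr => nu1 _ do rewrite (bigID (fun nu2 => ~~ descent nu2 nu1 nu)) /=.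
rewrite big_split /=; congr (_ + _); last first.
  by apply: eq_bigr => nu1 _; apply: eq_bigl => nu2; rewrite negbK.
rewrite [RHS]big_mkcond -(perm_big _ (perm_strips_merge a a' pn)) big_allpairs_dep.
rewrite [LHS]big_mkcond /=.
apply: eq_big_seq => nu1 /stripsP[p1 strip1 sum1]; rewrite big_filter.
transitivity (\sum_(nu2 <- strips a' nu1 | ~~ descent nu2 nu1 nu)
    if pb ==> descent nu1 nu pnu then chain_count L b nu1 nu2 else 0).
  by case: ifP => // _; rewrite big1.
apply: eq_big_seq_cond => nu2 /stripsP[p2 strip2 sum2] nodesc.
rewrite (descent_merge_strip _ strip1 strip2 nodesc); last lia.
case: L => [|[c e] L] //=; congr (if _ then _ else _).
apply: eq_bigl => nu3; congr (_ ==> _).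
by apply: descent_merge_above strip1 strip2 nodesc _; lia.
Qed.

Lemma chain_count_merge_cat L1 a a' b L pb pnu nu : 0 < a -> 0 < a' -> is_partition nu ->
  chain_count (L1 ++ (a, false) :: (a', b) :: L) pb pnu nu =
  chain_count (L1 ++ (a + a', b) :: L) pb pnu nu +
  chain_count (L1 ++ (a, true) :: (a', b) :: L) pb pnu nu.
Proof.
move=> a_gt0 a'_gt0; elim: L1 pb pnu nu => [|[c e] L1 IHL] pb pnu nu pn.
  exact: chain_count_merge.
rewrite /= -big_split; apply: eq_big_seq_cond => ka /stripsP[pk _ _] _.
exact: IHL.
Qed.

(** * The Schur expansion of a ribbon *)

Lemma adjacencies_cat L1 a a' b L : 0 < a -> 0 < a' -> exists c1 c2,
  (forall b0, adjacencies (L1 ++ (a, b0) :: (a', b) :: L) = c1 ++ overlap_adjacency b0 :: c2) /\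
  adjacencies (L1 ++ (a + a', b) :: L) = c1 ++ Weak :: c2.
Proof.
move=> a_gt0 a'_gt0; elim: L1 => [|[c e] L1 [c1 [c2 [split_eq merge_eq]]]].
  exists (nseq a.-1 Weak), (adjacencies ((a', b) :: L)); split=> //=.
  have -> : (a + a').-1 = a.-1 + a'.-1.+1 by lia.
  by rewrite nseqD -catA.
exists (nseq c.-1 Weak ++ overlap_adjacency e :: c1), c2.
by split=> [b0|]; rewrite cat_cons adjacencies_cons ?size_cat ?addnS // ?split_eq ?merge_eq -catA.
Qed.

Local Open Scope ring_scope.

Section Expansion.
Variables (R : comPzRingType) (x : nat -> R) (n : nat).

Definition chain_schur_sum (L : seq (nat * bool)) : R :=
  \sum_(nu <- partitions (sumn (unzip1 L)))
     (chain_count L false [::] nu)%:R * schur_poly x n nu.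

Lemma ribbon_words_merge L1 a a' b L : (0 < a)%N -> (0 < a')%N ->
  ribbon_words x n (L1 ++ (a, false) :: (a', b) :: L) =
  ribbon_words x n (L1 ++ ((a + a')%N, b) :: L) +
  ribbon_words x n (L1 ++ (a, true) :: (a', b) :: L).
Proof.
move=> a_gt0 a'_gt0; have [c1 [c2 [split_eq merge_eq]]] := adjacencies_cat L1 b L a_gt0 a'_gt0.
have wordsE M : (0 < size M)%N -> ribbon_words x n M = words x n (adjacencies M) by case: M.
by rewrite !wordsE ?size_cat ?addnS // !split_eq merge_eq words_free_split.
Qed.

Lemma chain_schur_sum_merge L1 a a' b L : (0 < a)%N -> (0 < a')%N ->
  chain_schur_sum (L1 ++ (a, false) :: (a', b) :: L) =
  chain_schur_sum (L1 ++ ((a + a')%N, b) :: L) +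
  chain_schur_sum (L1 ++ (a, true) :: (a', b) :: L).
Proof.
move=> a_gt0 a'_gt0; rewrite /chain_schur_sum /unzip1 !map_cat !sumn_cat /= -addnA -big_split /=.
apply: eq_big_seq => nu; rewrite mem_partitions => /andP[pn _].
by rewrite chain_count_merge_cat // natrD mulrDl.
Qed.

Lemma ribbon_words_cons_free a L : (0 < a)%N ->
  ribbon_words x n ((a, false) :: L) = complete_poly x n a * ribbon_words x n L.
Proof.
move=> a_gt0; case: L => [|p L]; first by rewrite /= cats0 mulr1 words_weak prednK.
by rewrite [LHS]/= words_weak_free words_weak prednK.
Qed.

Lemma chain_schur_sum_cons_free a L :
  chain_schur_sum ((a, false) :: L) = complete_poly x n a * chain_schur_sum L.
Proof.
rewrite /chain_schur_sum mulr_sumr [sumn _]/= addnC.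
transitivity (\sum_(ka <- partitions (sumn (unzip1 L)))
   \sum_(nu <- partitions (sumn (unzip1 L) + a) | hstrip nu ka)
     (chain_count L false [::] ka)%:R * schur_poly x n nu); last first.
  apply: eq_big_seq => ka; rewrite mem_partitions => /andP[pk /eqP sum_ka].
  by rewrite mulrCA pieri // sum_ka mulr_sumr.
rewrite sum_strips_exchange; apply: eq_bigr => nu _.
rewrite -mulr_suml [chain_count (_ :: _) _ _ _]/= natr_sum; congr (_ * _).
by apply: eq_bigr => ka _; rewrite chain_count_false.
Qed.

Lemma ribbon_words_free L : all (fun r => 0 < r.1)%N L -> all (fun r => ~~ r.2) L ->
  ribbon_words x n L = chain_schur_sum L.
Proof.
elim: L => [|[a b] L IHL].
  by rewrite /chain_schur_sum partitions0 big_seq1 /= schur_poly_nil mulr1.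
case: b => // /andP[a_gt0 rows_gt0] no_overlap.
by rewrite ribbon_words_cons_free // IHL // chain_schur_sum_cons_free.
Qed.

Lemma ribbon_words_chain L : all (fun r => 0 < r.1)%N L -> ~~ (last (0%N, false) L).2 ->
  ribbon_words x n L = chain_schur_sum L.
Proof.
have [k] := ubnP (count snd L); elim: k L => // k IHk L lt_k rows_gt0 last_free.
case: (boolP (has snd L)) => [/hasP[[a []] // mem_r _]|/hasPn no_overlap]; last first.
  by apply: ribbon_words_free => //; apply/allP => r /no_overlap.
move: lt_k rows_gt0 last_free; case/splitPr: mem_r => L1 [|[a' b] L2]; first by rewrite last_cat.
rewrite !count_cat all_cat last_cat /= => lt_k /and4P[L1_gt0 a_gt0 a'_gt0 L2_gt0] last_free.
apply: (@addrI _ (ribbon_words x n (L1 ++ ((a + a')%N, b) :: L2))).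
rewrite -ribbon_words_merge // [in RHS]IHk.
- rewrite -chain_schur_sum_merge //; apply: IHk; first by rewrite !count_cat /=; lia.
    by rewrite all_cat /= L1_gt0 a_gt0 a'_gt0.
  by rewrite last_cat.
- by rewrite !count_cat /=; lia.
- by rewrite all_cat /= L1_gt0 L2_gt0 addn_gt0 a_gt0.
by rewrite last_cat; case: (L2) last_free.
Qed.

End Expansion.

Local Close Scope ring_scope.

(** * Linear independence of Schur polynomials *)

Lemma count_ltnS (T : Type) (f : T -> nat) j s :
  count (fun c => f c < j.+1) s = count (fun c => f c < j) s + count (fun c => f c == j) s.
Proof.
rewrite -count_predUI [X in _ + X](eq_count (a2 := pred0)) => [|c /=]; last lia.
by rewrite count_pred0 addn0; apply: eq_count => c /=; lia.
Qed.

Lemma count_rows_leq nu j : count (fun c => c.1 <= j) (diagram nu [::]) = sumn (take j nu).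
Proof.
rewrite -size_diagram_straight -size_filter; apply: perm_size; apply: uniq_perm.
- by rewrite filter_uniq ?diagram_uniq.
- exact: diagram_uniq.
move=> [a b]; rewrite mem_filter !mem_diagram /part !nth_nil /=.
case: a => [|a] /=; first by rewrite ?andbF.
case: (ltnP a j) => [lt_aj|le_ja]; first by rewrite nth_take.
by rewrite [(take j nu)`_a]nth_default ?size_take_min; lia.
Qed.

Lemma count_row nu i : count (fun c => c.1 == i.+1) (diagram nu [::]) = nu`_i.
Proof.
have := count_ltnS (fun c => c.1) i.+1 (diagram nu [::]).
by rewrite !count_rows_leq sumn_takeS => /addnI.
Qed.

Lemma semistandard_row_leq nu g c : is_partition nu -> semistandard (diagram nu [::]) g ->
  c \in diagram nu [::] -> c.1 <= (g c).+1.
Proof.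
move=> pn [_ col_g]; case: c => i j; elim: i => // -[//|i] IHi D_ij.
have D_above : (i.+1, j) \in diagram nu [::].
  have [i' [j' [ei ej]]] := diagram_cellS D_ij; move: D_ij; rewrite ei ej -ei !mem_diagram_straight.
  by move/leq_trans; apply; apply: partition_nonincreasing.
by have := IHi D_above; have := col_g _ _ _ D_above D_ij (ltnSn _); rewrite /=; lia.
Qed.

Section Content.
Variables (n : nat) (nu : seq nat).
Hypothesis nu_part : is_partition nu.
Notation D := (diagram nu [::]).
Implicit Type T : {ffun seq_sub D -> 'I_n}.

Definition content T : 'X_{1..n} := (\sum_y U_(T y))%MM.
Definition row_monomial (ka : seq nat) : 'X_{1..n} := [multinom ka`_i | i < n].

Lemma contentE T (i : 'I_n) : content T i = count (fun c => filling T c == i) D.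
Proof.
rewrite /content mnm_sumE -sum1_count [RHS]big_mkcond /=.
rewrite -(big_seq_sub addn (fun c => if filling T c == i then 1 else 0)) ?diagram_uniq //.
by apply: eq_bigr => y _; rewrite mnmE filling_val val_eqE; case: (_ == _).
Qed.

Lemma mcoeff_schur ka :
  ((schur n nu)@_(row_monomial ka) =
   (\sum_(T : {ffun seq_sub D -> 'I_n} | is_ssyt T) (content T == row_monomial ka))%:R)%R.
Proof.
rewrite /schur /skew_schur raddf_sum natr_sum /=; apply: eq_bigr => T _.
by rewrite mprodXE mcoeffX.
Qed.

Lemma sumn_take_content T ka j : size ka <= n -> content T = row_monomial ka ->
  sumn (take j ka) = count (fun c => filling T c < j) D.
Proof.
move=> size_ka contentT; elim: j => [|j IHj].
  by rewrite take0 (eq_count (a2 := pred0)) ?count_pred0.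
rewrite sumn_takeS count_ltnS IHj; congr (_ + _); case: (ltnP j n) => [lt_jn|le_nj].
  by rewrite -[j]/(val (Ordinal lt_jn)) -contentE contentT mnmE.
rewrite nth_default ?(leq_trans size_ka) // (eq_in_count (a2 := pred0)) ?count_pred0 // => c Dc.
by rewrite ltn_eqF // (leq_trans (ltn_filling T Dc)).
Qed.

Lemma ssyt_dominance T ka j : size ka <= n -> is_ssyt T -> content T = row_monomial ka ->
  sumn (take j ka) <= sumn (take j nu).
Proof.
move=> size_ka /is_ssytP ssT contentT.
rewrite (sumn_take_content _ size_ka contentT) -count_rows_leq -!size_filter.
apply: uniq_leq_size => [|c]; first by rewrite filter_uniq ?diagram_uniq.
rewrite !mem_filter => /andP[lt_j Dc]; rewrite Dc andbT.
exact: leq_trans (semistandard_row_leq nu_part ssT Dc) lt_j.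
Qed.

Lemma superstandard_exists : size nu <= n ->
  exists2 T, is_ssyt T & content T = row_monomial nu.
Proof.
move=> size_nu; have row_lt : {in D, forall c, c.1.-1 < n}.
  move=> c Dc; have [i [j eq_c]] := diagram_cellS Dc; move: Dc.
  rewrite eq_c mem_diagram_straight /= => lt_j; apply: leq_trans size_nu.
  by rewrite -partition_nth_gt0 //; lia.
have fillingE := filling_tableau_of row_lt; exists (tableau_of row_lt).
  apply/is_ssytP; split=> [i j j'|i i' j] Dc Dc' lt; rewrite !fillingE //=.
  by move: Dc; rewrite mem_diagram; lia.
apply/mnmP => i; rewrite contentE mnmE -count_row; apply: eq_in_count => c Dc.
by rewrite fillingE //; have [i0 [j0 ->]] := diagram_cellS Dc.
Qed.

Lemma mcoeff_schur_diag : size nu <= n -> ((schur n nu)@_(row_monomial nu) != 0)%R.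
Proof.
move=> size_nu; have [T ssT contentT] := superstandard_exists size_nu.
by rewrite mcoeff_schur pnatr_eq0 (bigD1 T) //= contentT eqxx.
Qed.

Lemma mcoeff_schur_dominated ka : size ka <= n -> sumn ka = sumn nu ->
  ((schur n nu)@_(row_monomial ka) != 0)%R -> dominated ka nu.
Proof.
move=> size_ka sum_ka; rewrite mcoeff_schur pnatr_eq0 sum_nat_eq0 => /forallPn[T].
rewrite negb_imply eqb0 negbK => /andP[ssT /eqP contentT].
by split=> // j; apply: ssyt_dominance ssT contentT.
Qed.

End Content.

Definition dominance_height k (nu : seq nat) := \sum_(j < k.+1) sumn (take j nu).

Lemma dominance_height_lt k ka nu : is_partition ka -> is_partition nu -> sumn nu = k ->
  dominated ka nu -> nu != ka -> dominance_height k ka < dominance_height k nu.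
Proof.
move=> pk pn sum_nu [eq_sum dom]; rewrite ltnNge; apply: contra => le_height.
have eq_prefix j : sumn (take j ka) = sumn (take j nu).
  case: (leqP k.+1 j) => [lt_kj|lt_jk].
    have size_nu := partition_size_leq_sumn pn; have size_ka := partition_size_leq_sumn pk.
    by rewrite !take_oversize //; lia.
  apply/eqP; rewrite eqn_leq dom /= leqNgt; apply: contraL le_height => lt_j.
  rewrite -ltnNge /dominance_height (bigD1 (Ordinal lt_jk)) //= [ltnRHS](bigD1 (Ordinal lt_jk)) //=.
  by rewrite -addSn; apply: leq_add => //; apply: leq_sum => i _; apply: dom.
apply/eqP; apply: partition_ext => // i.
by have := sumn_takeS nu i; have := sumn_takeS ka i; rewrite !eq_prefix; lia.
Qed.

Lemma dominance_height_leq k nu : dominance_height k nu <= k.+1 * sumn nu.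
Proof.
rewrite -[X in X * _]card_ord -sum_nat_const; apply: leq_sum => j _; exact: leq_sumn_take.
Qed.

Local Open Scope ring_scope.

Lemma schur_independent k (d : seq nat -> int) :
  \sum_(nu <- partitions k) d nu *: schur k nu = 0 ->
  forall nu, nu \in partitions k -> d nu = 0.
Proof.
move=> sum0 ka.
(* Downward induction on dominance: the row monomial of [ka] occurs in [schur k nu] only if
   [nu] dominates [ka]. *)
have [m] := ubnP (k.+1 * k - dominance_height k ka)%N; elim: m ka => // m IHm ka lt_m mem_ka.
have := mem_ka; rewrite mem_partitions => /andP[pk /eqP sum_ka].
have size_ka : (size ka <= k)%N by rewrite -sum_ka partition_size_leq_sumn.
have := congr1 (mcoeff (row_monomial k ka)) sum0; rewrite mcoeff0 raddf_sum /=.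
rewrite (bigD1_seq ka) ?partitions_uniq //= big1_seq => [|nu]; last first.
  case/andP=> ne_nu mem_nu; have := mem_nu; rewrite mem_partitions => /andP[pn /eqP sum_nu].
  rewrite mcoeffZ; apply/eqP; rewrite mulf_eq0; apply/orP.
  case: (eqVneq (schur k nu)@_(row_monomial k ka)) => [_|coeff_neq0]; [by right | left].
  have eq_sum : sumn ka = sumn nu by rewrite sum_ka.
  have dom := mcoeff_schur_dominated pn size_ka eq_sum coeff_neq0.
  have lt_height := dominance_height_lt pk pn sum_nu dom ne_nu.
  have := dominance_height_leq k nu; rewrite sum_nu => le_height.
  by rewrite IHm //; lia.
rewrite addr0 mcoeffZ => /eqP; rewrite mulf_eq0 => /orP[/eqP //|].
by rewrite (negbTE (mcoeff_schur_diag pk size_ka)).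
Qed.

Local Close Scope ring_scope.

(** * Admissible partitions *)

Definition cells_from (L : seq (nat * bool)) i := sumn (drop i (unzip1 L)).

Definition overlaps_from (L : seq (nat * bool)) i := count snd (drop i L).

Definition admissible (L : seq (nat * bool)) (nu : seq nat) : Prop :=
  [/\ is_partition nu, dominated (unzip1 L) nu &
      forall i, nu`_i + overlaps_from L i <= cells_from L i].

Definition partition_ribbon (L : seq (nat * bool)) : Prop :=
  [/\ sorted geq (unzip1 L), all (leq 2) (unzip1 L) & ~~ (last (0, false) L).2].

Lemma last_free_behead r L : ~~ (last (0, false) (r :: L)).2 -> ~~ (last (0, false) L).2.
Proof. by case: L. Qed.

Lemma partition_ribbon_partition L : partition_ribbon L -> is_partition (unzip1 L).
Proof. by case=> srt /allP ge2 _; rewrite /is_partition srt; apply/negP => /ge2. Qed.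

Lemma partition_ribbon_behead r L : partition_ribbon (r :: L) -> partition_ribbon L.
Proof. by case=> /path_sorted srt /andP[_ ge2] /last_free_behead. Qed.

Lemma cells_fromS L i : cells_from L i = (unzip1 L)`_i + cells_from L i.+1.
Proof. by rewrite /cells_from sumn_behead nth_drop addn0 -drop1 drop_drop add1n. Qed.

Lemma cells_from_oversize L i : size L <= i -> cells_from L i = 0.
Proof. by move=> le_i; rewrite /cells_from drop_oversize ?size_map. Qed.

Lemma sum_rows_cells_from L i : \sum_(j < i) (unzip1 L)`_j + cells_from L i = sumn (unzip1 L).
Proof. by rewrite -sumn_take_sum -sumn_cat cat_take_drop. Qed.

Lemma cells_from_behead L i : cells_from (behead L) i = cells_from L i.+1.
Proof. by rewrite /cells_from -drop1 /unzip1 map_drop drop_drop addn1. Qed.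

Lemma overlaps_from_behead L i : overlaps_from (behead L) i = overlaps_from L i.+1.
Proof. by rewrite /overlaps_from -drop1 drop_drop addn1. Qed.

Lemma cells_from_ge L i : all (leq 2) (unzip1 L) -> 2 * (size L - i) <= cells_from L i.
Proof.
move=> ge2; rewrite /cells_from -(size_map fst L) -/(unzip1 L) -size_drop.
have : all (leq 2) (drop i (unzip1 L)) by apply/allP => a /mem_drop; apply/allP.
by elim: (drop i _) => //= a s IHs /andP[a_ge2 /IHs]; lia.
Qed.

Lemma overlaps_fromS L i : overlaps_from L i = (nth (0, false) L i).2 + overlaps_from L i.+1.
Proof.
rewrite /overlaps_from; case: (ltnP i (size L)) => [lt_i|le_i].
  by rewrite (drop_nth (0, false)).
by rewrite nth_default // !drop_oversize // ltnW.
Qed.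

Lemma overlaps_from_leq L i : ~~ (last (0, false) L).2 -> overlaps_from L i <= size L - i.+1.
Proof.
case/lastP: L => [//|L r]; rewrite last_rcons /overlaps_from size_rcons subSS => r_free.
case: (leqP i (size L)) => [le_i|lt_i]; last by rewrite drop_oversize ?size_rcons.
by rewrite drop_rcons // -cats1 count_cat /= (negbTE r_free) !addn0 -size_drop count_size.
Qed.

Lemma hstrip_take nu ka a k : hstrip nu ka -> sumn nu = sumn ka + a ->
  a + sumn (take k ka) <= sumn (take k.+1 nu).
Proof.
move=> /hstripP strip; rewrite -{1}(cat_take_drop k ka) -{1}(cat_take_drop k.+1 nu) !sumn_cat.
have : sumn (drop k.+1 nu) <= sumn (drop k ka); last lia.
by apply: leq_sumn_nth => i; rewrite !nth_drop addSn; have := strip (k + i); lia.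
Qed.

Lemma hstrip_row0 nu ka a : hstrip nu ka -> sumn nu = sumn ka + a -> nu`_0 <= ka`_0 + a.
Proof.
move=> /hstripP strip; rewrite [sumn nu]sumn_behead [sumn ka]sumn_behead.
have : sumn (behead ka) <= sumn (behead nu); last lia.
by apply: leq_sumn_nth => i; rewrite !nth_behead; case/andP: (strip i.+1).
Qed.

Lemma hstrip_row0_strict nu ka a j : hstrip nu ka -> sumn nu = sumn ka + a ->
  0 < j -> ka`_j < nu`_j -> nu`_0 < ka`_0 + a.
Proof.
case: j => // j /hstripP strip; rewrite [sumn nu]sumn_behead [sumn ka]sumn_behead => sum_nu _ lt_j.
have : sumn (behead ka) < sumn (behead nu); last lia.
apply: (@ltn_sumn_nth _ _ j) => [i|]; rewrite !nth_behead //.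
by case/andP: (strip i.+1).
Qed.

Lemma chain_count_admissible L pb pnu nu : ~~ (last (0, false) L).2 -> is_partition nu ->
  0 < chain_count L pb pnu nu ->
  admissible L nu /\ (pb -> L <> [::] -> exists2 j, 0 < j & nu`_j < pnu`_j).
Proof.
elim: L pb pnu nu => [|[a b] L IHL] pb pnu nu last_free pn.
  by rewrite /= lt0b => /eqP ->; split=> //; split=> // i; rewrite nth_nil.
rewrite [chain_count _ _ _ _]/= lt0n sum_nat_seq_neq0 => /hasP[ka /stripsP[pk strip sum_nu]].
rewrite -lt0n => /andP[desc /(IHL _ _ _ (last_free_behead last_free) pk)].
move=> [[_ [sum_ka dom] bound] next_desc].
split=> [|pb_true _]; last first.
  move: desc; rewrite pb_true => /descentP[i [j [lt_ij _ lt_j]]].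
  by exists j => //; lia.
split=> //; first split=> [|[//|k]].
- by rewrite sum_nu -sum_ka addnC.
- by have := hstrip_take k strip sum_nu; have := dom k; rewrite /=; lia.
case=> [|i]; last first.
  by have := bound i; have /hstripP/(_ i) := strip; rewrite /overlaps_from /cells_from /=; lia.
have := bound 0; rewrite /overlaps_from /cells_from !drop0 /=.
case: b last_free next_desc {desc} => last_free next_desc; last first.
  by have := hstrip_row0 strip sum_nu; lia.
have [//||j j_gt0 lt_j] := next_desc; first by move: last_free; case: (L).
by have := hstrip_row0_strict strip sum_nu j_gt0 lt_j; lia.
Qed.

Lemma nonincreasing_sum_geq f k : nonincreasing f -> f 0 + k * f k <= \sum_(j < k.+1) f j.
Proof.
move=> f_dec; rewrite sum_ord_recl leq_add2l -[X in X * _]card_ord -sum_nat_const.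
by apply: leq_sum => j _; apply: nonincreasing_leq.
Qed.

Lemma nonincreasing_sum_leq f k : nonincreasing f -> \sum_(j < k) f j <= k * f 0.
Proof.
move=> f_dec; rewrite -[X in X * _]card_ord -sum_nat_const.
by apply: leq_sum => j _; apply: nonincreasing_leq.
Qed.

Lemma sum_gt0_geq (f : nat -> nat) i k : i <= k -> (forall j, i <= j < k -> 0 < f j) ->
  \sum_(j < i) f j + (k - i) <= \sum_(j < k) f j.
Proof.
elim: k => [|k IHk]; first by rewrite leqn0 => /eqP -> _; rewrite addn0.
rewrite leq_eqVlt => /predU1P[-> _|lt_ik f_gt0]; first by rewrite subnn addn0.
have := IHk lt_ik (fun j lt_j => f_gt0 j ltac:(lia)); rewrite sum_ord_recr.
by have := f_gt0 k; lia.
Qed.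

Section RemoveStrip.
Variables (L : seq (nat * bool)) (nu : seq nat).
Hypotheses (L_ribbon : partition_ribbon L) (nu_adm : admissible L nu) (L_gt0 : 0 < size L).
Notation l := (size L).
Notation al i := ((unzip1 L)`_i).

Let al_dec : nonincreasing (nth 0 (unzip1 L)).
Proof. by apply/sorted_geqP; case: L_ribbon. Qed.

Let al_ge2 i : i < l -> 2 <= al i.
Proof. by case: L_ribbon => _ /(all_nthP 0) ge2 _ lt_i; apply: ge2; rewrite size_map. Qed.

Let cells_ge i : 2 * (l - i) <= cells_from L i.
Proof. by apply: cells_from_ge; case: L_ribbon. Qed.

Let overlaps_le i : overlaps_from L i <= l - i.+1.
Proof. by apply: overlaps_from_leq; case: L_ribbon. Qed.

Let nu_part : is_partition nu. Proof. by case: nu_adm. Qed.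

Let nu_dec : nonincreasing (nth 0 nu). Proof. exact: partition_nonincreasing. Qed.

Let nu_le i j : i <= j -> nu`_j <= nu`_i. Proof. exact: partition_nth_leq. Qed.

Let nu_bound i : nu`_i + overlaps_from L i <= cells_from L i. Proof. by case: nu_adm. Qed.

Let nu_dom k : \sum_(j < k) al j <= \sum_(j < k) nu`_j.
Proof. by case: nu_adm => _ [_ dom] _; rewrite -!sumn_take_sum. Qed.

Let nu_l i : l <= i -> nu`_i = 0.
Proof. by move=> le_i; have := nu_bound i; rewrite cells_from_oversize; lia. Qed.

Let nu_sum : \sum_(j < l) nu`_j = cells_from L 0.
Proof.
rewrite sum_nth_sumn ?partition_size_leq ?nu_l //.
by case: nu_adm => _ [<- _] _; rewrite /cells_from drop0.
Qed.

Let sum_al k : \sum_(j < k) al j + cells_from L k = cells_from L 0.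
Proof. by rewrite sum_rows_cells_from /cells_from drop0. Qed.

Let sum_next_al k : \sum_(j < k) al j.+1 + cells_from L k.+1 = cells_from L 1.
Proof. by have := sum_al k.+1; rewrite sum_ord_recl (cells_fromS L 0) -addnA => /addnI. Qed.

Let row0_ge : al 0 <= nu`_0. Proof. by have := nu_dom 1; rewrite !big_ord1. Qed.

Let row0_ge2 : 2 <= nu`_0. Proof. exact: leq_trans (al_ge2 L_gt0) row0_ge. Qed.

Lemma last_longest_row_exists : exists2 m, nu`_m = nu`_0 & nu`_m.+1 < nu`_0.
Proof.
have ex_shorter : exists k, nu`_k < nu`_0 by exists l; rewrite nu_l //; lia.
case: (ex_minnP ex_shorter) => -[|m]; first by rewrite ltnn.
move=> lt_m m_min; exists m => //; apply/eqP; rewrite eqn_leq nu_le //= leqNgt.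
by apply/negP => /m_min; rewrite ltnn.
Qed.

Section LastLongestRow.
Variable m : nat.
Hypotheses (nu_m : nu`_m = nu`_0) (nu_mS : nu`_m.+1 < nu`_0).

(* The next partition stays below [clipped], so that the removed strip reaches the last
   column: the next strip that leaves the first row is then a descent. *)
Definition clipped j := nu`_j - (j == m).
Definition capacity j := cells_from L j.+1 - overlaps_from L j.+1.
Definition room j := minn (clipped j) (capacity j).
Definition active j := capacity j < clipped j.

Let capacityE j : capacity j + overlaps_from L j.+1 = cells_from L j.+1.
Proof. by rewrite /capacity; have := nu_bound j.+1; lia. Qed.

Let capacity_ge j : j.+1 < l -> l - j <= capacity j.
Proof. by move=> lt_j; have := cells_ge j.+1; have := overlaps_le j.+1; rewrite /capacity; lia. Qed.

Lemma room_active j : active j -> room j = capacity j.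
Proof. by rewrite /active /room; lia. Qed.

Lemma room_inactive j : ~~ active j -> room j = clipped j.
Proof. by rewrite /active /room -leqNgt; lia. Qed.

Lemma room_gt0 j : j.+1 < l -> 0 < nu`_j -> 0 < room j.
Proof.
move=> lt_j nu_j; have := capacity_ge lt_j; move: lt_j; rewrite /room /clipped.
by case: eqP => [->|_] /=; have := row0_ge2; lia.
Qed.

Lemma sum_clipped k : \sum_(j < k) clipped j + (m < k) = \sum_(j < k) nu`_j.
Proof.
elim: k => [|k IHk]; first by rewrite !big_ord0.
rewrite !sum_ord_recr -IHk ltnS leq_eqVlt {2}/clipped eq_sym.
by case: (eqVneq m k) => [<-|ne_mk] /=; rewrite ?ltnn; lia.
Qed.

Lemma clipped_dom k : k < l -> \sum_(j < k) al j.+1 <= \sum_(j < k) clipped j.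
Proof.
move=> lt_k; have clip := sum_clipped k; have next := sum_next_al k; have cells := sum_al k.
have dom := nu_dom k; have domS := nu_dom k.+1; rewrite !sum_ord_recr in domS.
have al_k := nonincreasing_leq al_dec (leq0n k).
have cells0 := cells_fromS L 0; have cells_k := cells_fromS L k.
case: (ltnP m k) clip => [lt_mk|_] clip; rewrite ?addn1 ?addn0 in clip; last lia.
rewrite leqNgt; apply/negP => gt.
have al_kE : al k = al 0 by lia.
have nu_k : nu`_k < nu`_0 by apply: leq_ltn_trans nu_mS; apply: nu_le.
have sum_geq := nonincreasing_sum_geq k nu_dec; rewrite sum_ord_recr in sum_geq.
have sum_leq := nonincreasing_sum_leq k al_dec.
have mul_le : k * al 0 <= k * nu`_k by apply: leq_mul => //; lia.
lia.
Qed.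

(* A row is active when the bound [capacity] cuts into it. Above the first active row the
   dominance is [clipped_dom]; below it little is missing, since [capacity] falls short of the
   sum of all remaining parts only by the number of remaining overlaps. *)
Lemma first_active k :
  (forall j, j < k -> ~~ active j) \/
  exists i, [/\ i < k, active i & forall j, j < i -> ~~ active j].
Proof.
case: (boolP [exists j : 'I_k, active j]) => [/existsP[j act_j]|/existsPn no_active]; last first.
  by left=> j lt_j; apply: (no_active (Ordinal lt_j)).
right; have ex_active : exists i, active i by exists j.
case: (ex_minnP ex_active) => i act_i i_min; exists i; split=> //.
  exact: leq_ltn_trans (i_min _ act_j) _.
by move=> j' lt_j'; apply/negP => /i_min; rewrite leqNgt lt_j'.
Qed.

Lemma sum_room_inactive k : (forall j, j < k -> ~~ active j) ->
  \sum_(j < k) room j = \sum_(j < k) clipped j.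
Proof. by move=> no_active; apply: eq_bigr => j _; rewrite room_inactive ?no_active. Qed.

Lemma room_dom_first_active i : i < l -> active i -> (forall j, j < i -> ~~ active j) ->
  cells_from L 1 <= \sum_(j < i.+1) room j + overlaps_from L i.+1.
Proof.
move=> lt_i act_i no_active; have := clipped_dom lt_i; have := sum_next_al i.
by rewrite sum_ord_recr room_active // sum_room_inactive //; have := capacityE i; lia.
Qed.

Lemma sum_room_geq i k : i <= k -> k < l -> 0 < nu`_k.-1 ->
  \sum_(j < i) room j + (k - i) <= \sum_(j < k) room j.
Proof.
move=> le_ik lt_k nu_k; apply: sum_gt0_geq => // j lt_j; apply: room_gt0; first lia.
by apply: leq_trans nu_k _; apply: nu_le; lia.
Qed.

Lemma room_dom_positive k : k < l -> 0 < nu`_k.-1 ->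
  \sum_(j < k) al j.+1 <= \sum_(j < k) room j.
Proof.
move=> lt_k nu_k; case: (first_active k) => [no_active|[i [lt_ik act_i no_active]]].
  by rewrite sum_room_inactive //; apply: clipped_dom.
have := room_dom_first_active (ltn_trans lt_ik lt_k) act_i no_active.
have := sum_room_geq lt_ik lt_k nu_k; have := sum_next_al k.
by have := cells_ge k.+1; have := overlaps_le i.+1; lia.
Qed.

Lemma total_room_two_active i i' : i < i' -> i'.+1 < l ->
  active i -> (forall j, j < i -> ~~ active j) -> active i' ->
  cells_from L 1 <= \sum_(j < l) room j.
Proof.
move=> lt_ii' lt_i' act_i no_active act_i'.
have nu_i' : 0 < nu`_i' by move: act_i'; rewrite /active /clipped; lia.
have nu_pred : 0 < nu`_i'.-1 by apply: leq_trans nu_i' _; apply: nu_le; lia.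
have lt_il : i < l by lia.
have := room_dom_first_active lt_il act_i no_active.
have := sum_room_geq lt_ii' (ltnW lt_i') nu_pred.
have := overlaps_le i.+1; have := capacity_ge lt_i'.
by have := leq_sum_prefix room (ltnW lt_i'); rewrite sum_ord_recr (room_active act_i'); lia.
Qed.

Lemma active_excess_ltn i : i.+1 < l -> active i -> clipped i < al 0 + capacity i.
Proof.
move=> lt_i act_i; have al_i := nonincreasing_leq al_dec (leq0n i).
have bound := nu_bound i; have := capacityE i; have := cells_fromS L i; have := overlaps_fromS L i.
case: (ltngtP i m) => [lt_im|lt_mi|eq_im] overs cells cap.
- have : nu`_m <= nu`_i.+1 by apply: nu_le.
  have := nu_bound i.+1; have := nu_dec i; have := nu_le (leq0n i).
  by move: act_i; rewrite /active /clipped; lia.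
- have -> : clipped i = nu`_i by rewrite /clipped; lia.
  rewrite ltnNge; apply/negP => ge_i; have nu_i : nu`_i = al 0 + capacity i by lia.
  have nu_i0 : nu`_i < nu`_0 by apply: leq_ltn_trans nu_mS; apply: nu_le.
  have sum_geq := nonincreasing_sum_geq i nu_dec.
  have sum_leq := nonincreasing_sum_leq i al_dec.
  have := leq_sum_prefix (nth 0 nu) (ltnW lt_i); rewrite nu_sum => le_total.
  have := sum_al i; have := overlaps_le i.+1; have := capacity_ge lt_i.
  have : capacity i <= i * capacity i by rewrite leq_pmull //; lia.
  by move: sum_geq; rewrite nu_i mulnDr; lia.
by rewrite /clipped eq_im eqxx /=; rewrite eq_im in al_i bound overs cells cap; lia.
Qed.

Lemma total_room_one_active i : i.+1 < l -> active i ->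
  (forall j, j < l -> j != i -> ~~ active j) -> cells_from L 1 <= \sum_(j < l) room j.
Proof.
move=> lt_i act_i others; have lt_il := ltnW lt_i.
have split_i (f : nat -> nat) : \sum_(j < l) f j = f i + \sum_(j < l | val j != i) f j.
  by rewrite (bigD1 (Ordinal lt_il)).
have eq_rest : \sum_(j < l | val j != i) room j = \sum_(j < l | val j != i) clipped j.
  by apply: eq_bigr => j ne_ji; rewrite room_inactive ?others.
have := sum_clipped l; have := active_excess_ltn lt_i act_i; have := cells_fromS L 0.
by rewrite nu_sum (split_i room) (split_i clipped) eq_rest (room_active act_i); lia.
Qed.

Lemma total_room : cells_from L 1 <= \sum_(j < l) room j.
Proof.
case: (posnP nu`_l.-2) => [nu_l2|nu_l2]; last first.
  have lt_l : l.-1 < l by lia.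
  have := room_dom_positive lt_l nu_l2; have := sum_next_al l.-1; rewrite prednK //.
  by have := leq_sum_prefix room (ltnW lt_l); rewrite cells_from_oversize //; lia.
have active_lt j : active j -> j.+2 < l.
  move=> act_j; rewrite ltnNge; apply/negP => ge_l; have := nu_le (_ : l.-2 <= j).
  by move: act_j; rewrite /active /clipped; lia.
case: (first_active l) => [no_active|[i [lt_i act_i no_active]]].
  rewrite sum_room_inactive //; have := sum_clipped l; rewrite nu_sum.
  by have := al_ge2 L_gt0; have := cells_fromS L 0; lia.
case: (boolP [exists j : 'I_l, (i < j) && active j]) => [/existsP[j]|/existsPn no_later].
  case/andP=> lt_ij act_j.
  exact: total_room_two_active lt_ij (ltnW (active_lt _ act_j)) act_i no_active act_j.
apply: (total_room_one_active (ltnW (active_lt _ act_i)) act_i) => j lt_j ne_ji.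
case: (ltngtP j i) => [/no_active //|lt_ij|eq_ji]; last by rewrite eq_ji eqxx in ne_ji.
by have := no_later (Ordinal lt_j); rewrite /= lt_ij.
Qed.

Lemma room_dom k : k < l -> \sum_(j < k) al j.+1 <= \sum_(j < k) room j.
Proof.
move=> lt_k; case: (posnP nu`_k.-1) => [nu_k|]; last exact: room_dom_positive.
have eq_total : \sum_(j < l) room j = \sum_(j < k) room j.
  rewrite (big_ord_widen l room (ltnW lt_k)) [RHS]big_mkcond; apply: eq_bigr => j _.
  case: ltnP => // le_kj; have := nu_le (_ : k.-1 <= j); rewrite /room /clipped; lia.
by have := total_room; rewrite eq_total; have := sum_next_al k; lia.
Qed.

Let row_room j : nu`_j.+1 <= room j.
Proof.
rewrite /room leq_min; apply/andP; split; last by have := capacityE j; have := nu_bound j.+1; lia.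
by rewrite /clipped; have := nu_dec j; case: eqP => [->|_] /=; lia.
Qed.

(* The most dominant sequence between the shifted rows of [nu] and [room]. *)
Definition next_row j := nu`_j.+1 + topfill (fun i => room i - nu`_i.+1) (nu`_0 - al 0) j.

Lemma next_row_leq j : next_row j <= room j.
Proof. by have := row_room j; rewrite /next_row /topfill; lia. Qed.

Lemma next_row_leq_row j : next_row j <= nu`_j.
Proof. by have := next_row_leq j; rewrite /room /clipped; lia. Qed.

Lemma next_row_nonincreasing : nonincreasing next_row.
Proof. by move=> j; apply: leq_trans (next_row_leq_row _) _; apply: leq_addr. Qed.

Lemma next_row_default j : l <= j.+1 -> next_row j = 0.
Proof.
by move=> le_j; have := next_row_leq j; rewrite /room /capacity cells_from_oversize //; lia.
Qed.

Lemma sum_next_row k :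
  \sum_(j < k) next_row j + nu`_0 =
  minn (\sum_(j < k) room j + nu`_0) (\sum_(j < k.+1) nu`_j + (nu`_0 - al 0)).
Proof.
have sum_room : \sum_(j < k) room j = \sum_(j < k) nu`_j.+1 + \sum_(j < k) (room j - nu`_j.+1).
  by rewrite -big_split; apply: eq_bigr => j _; have := row_room j; rewrite /=; lia.
have sum_next : \sum_(j < k) next_row j =
    \sum_(j < k) nu`_j.+1 + minn (nu`_0 - al 0) (\sum_(j < k) (room j - nu`_j.+1)).
  by rewrite -(sum_topfill (fun i => room i - nu`_i.+1)) -big_split.
by rewrite sum_room sum_next sum_ord_recl; lia.
Qed.

Lemma total_next_row : \sum_(j < l) next_row j = cells_from L 1.
Proof.
have := sum_next_row l; rewrite sum_ord_recr nu_sum (nu_l (leqnn l)).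
have := total_room; have := cells_fromS L 0; have := nu_bound 0; have := row0_ge; lia.
Qed.

Lemma next_row_dom k : \sum_(j < k) al j.+1 <= \sum_(j < k) next_row j.
Proof.
case: (ltnP k l) => [lt_k|le_lk].
  have := sum_next_row k; have := room_dom lt_k; have := nu_dom k.+1; rewrite !sum_ord_recl.
  by have := row0_ge; lia.
have := leq_sum_prefix next_row le_lk; rewrite total_next_row.
by have := sum_next_al k; lia.
Qed.

Lemma next_row_descends : (nth (0, false) L 0).2 -> exists2 j, 0 < j & next_row j < nu`_j.
Proof.
move=> overlap0; case: (boolP [exists j : 'I_l, (0 < j) && (next_row j < nu`_j)]).
  by case/existsP=> j /andP[]; exists j.
move/existsPn=> no_row; have next_tail j : next_row j.+1 = nu`_j.+1.
  case: (ltnP j.+1 l) => [lt_j|le_lj]; last by rewrite next_row_default ?nu_l // ltnW.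
  by have := no_row (Ordinal lt_j); have := next_row_leq_row j.+1; rewrite /=; lia.
have sum_tail : \sum_(j < l) next_row j + nu`_0 = next_row 0 + \sum_(j < l) nu`_j.
  rewrite -(prednK L_gt0) !sum_ord_recl; under eq_bigr => j _ do rewrite next_tail.
  by rewrite addnCA addnC addnA.
have single_row : nu`_1 = 0 -> nu`_0 = cells_from L 0.
  move=> nu_1; rewrite -nu_sum -(prednK L_gt0) sum_ord_recl big1 ?addn0 // => j _.
  by have := nu_le (ltn0Sn j); rewrite nu_1; lia.
rewrite total_next_row nu_sum in sum_tail.
have := sum_next_row 1; rewrite !sum_ord_recr !big_ord0 !add0n /room /clipped.
have := cells_fromS L 0; have := overlaps_fromS L 0; rewrite overlap0.
by have := nu_bound 0; have := capacityE 0; have := al_ge2 L_gt0; have := row0_ge; lia.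
Qed.

Definition next_partition := partition_of next_row l.

Lemma nth_next_partition j : next_partition`_j = next_row j.
Proof. exact: nth_partition_of next_row_nonincreasing (next_row_default (leqnSn l)) j. Qed.

Lemma next_partition_hstrip : hstrip nu next_partition.
Proof.
by apply/hstripP => j; rewrite nth_next_partition next_row_leq_row andbT; apply: leq_addr.
Qed.

Lemma next_partition_admissible : admissible (behead L) next_partition.
Proof.
have next_dec := next_row_nonincreasing; have next_l := next_row_default (leqnSn l).
have alE j : (unzip1 (behead L))`_j = al j.+1 by rewrite /unzip1 -behead_map nth_behead.
split; first exact: partition_of_partition.
  split=> [|k].
    by rewrite sumn_partition_of // total_next_row -cells_from_behead /cells_from drop0.
  rewrite !sumn_take_sum; under eq_bigr => j _ do rewrite alE.
  by under [leqRHS]eq_bigr => j _ do rewrite nth_next_partition; apply: next_row_dom.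
move=> j; rewrite nth_next_partition cells_from_behead overlaps_from_behead.
by have := next_row_leq j; have := capacityE j; rewrite /room; lia.
Qed.

Lemma next_row_last_longest : next_row m < nu`_m.
Proof. by have := next_row_leq m; rewrite /room /clipped eqxx; lia. Qed.

End LastLongestRow.

Lemma admissible_next_partition : exists ka m,
  [/\ admissible (behead L) ka, hstrip nu ka, nu`_m = nu`_0, ka`_m < nu`_m &
      (nth (0, false) L 0).2 -> exists2 j, 0 < j & ka`_j < nu`_j].
Proof.
have [m nu_m nu_mS] := last_longest_row_exists; exists (next_partition m), m; split=> //.
- exact: next_partition_admissible.
- exact: next_partition_hstrip.
- by rewrite nth_next_partition //; apply: next_row_last_longest.
move=> /(next_row_descends nu_m nu_mS)[j j_gt0 lt_j].
by exists j; rewrite ?nth_next_partition.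
Qed.

End RemoveStrip.

Lemma chain_count_gt0 L (pb : bool) pnu nu : partition_ribbon L -> admissible L nu ->
  (pb -> hstrip pnu nu /\ exists2 j, 0 < j & nu`_j < pnu`_j) ->
  0 < chain_count L pb pnu nu.
Proof.
elim: L pb pnu nu => [|[a b] L IHL] pb pnu nu ribbon adm prev.
  have [pn [/esym/eqP sum_nu _] _] := adm.
  by rewrite /= lt0b -partition_sumn0.
have [ka [m [adm_ka strip nu_m lt_m descends]]] := admissible_next_partition ribbon adm isT.
have [[pn [sum_nu _] _] [pk [sum_ka _] _]] := (adm, adm_ka).
have mem_ka : ka \in strips a nu by apply/stripsP; split; rewrite // -sum_nu -sum_ka addnC.
rewrite [chain_count _ _ _ _]/= lt0n sum_nat_seq_neq0; apply/hasP; exists ka => //.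
apply/andP; split; last first.
  rewrite -lt0n; apply: IHL adm_ka _ => [|b_true]; first exact: partition_ribbon_behead ribbon.
  by split; last exact: descends.
apply/implyP => /prev[/hstripP strip_prev [j j_gt0 lt_j]].
apply/descentP; exists m, j; split=> //.
(* Row [j] of [nu] is shorter than row [j.-1], so the last longest row lies above it. *)
rewrite ltnNge; apply/negP => le_jm.
have := strip_prev j.-1; rewrite prednK // => /andP[le_prev _].
have := partition_nth_leq pn le_jm; have := partition_nth_leq pn (leq0n j.-1); lia.
Qed.

(** * The support of a ribbon *)

Section RibbonSupport.
Variables lam mu : seq nat.
Hypothesis ribbon : ribbon_ge2 lam mu.
Notation l := (size lam).
Notation L := (ribbon_rows lam mu 1 l).

Let lam_part : is_partition lam. Proof. by case: ribbon. Qed.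

Let row_ge2 i : 1 <= i <= l -> part mu i + 2 <= part lam i.
Proof. by case: ribbon => _ _ + _; apply. Qed.

Let row_next i : 1 <= i -> part lam i.+1 <= (part mu i).+1.
Proof. by case: ribbon => _ _ _; apply. Qed.

Lemma size_ribbon_rows : size L = l.
Proof. by rewrite size_map size_iota. Qed.

Lemma nth_ribbon_rows i : i < l ->
  nth (0, false) L i = (part lam i.+1 - part mu i.+1, overlap lam mu i.+1).
Proof. by move=> lt_i; rewrite (nth_map 0) ?size_iota // nth_iota. Qed.

Lemma last_ribbon_rows : ~~ (last (0, false) L).2.
Proof.
case: (posnP l) => [->|l_gt0] //; rewrite -nth_last size_ribbon_rows nth_ribbon_rows; last lia.
by rewrite /= /overlap (@part_gt_size lam); lia.
Qed.

Lemma column_length_fromS i j :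
  column_length_from lam mu i j = ((i, j) \in diagram lam mu) + column_length_from lam mu i.+1 j.
Proof.
rewrite /column_length_from -(count_uniq_mem (i, j) (diagram_uniq lam mu)) -count_predUI.
rewrite [X in _ = _ + X](eq_count (a2 := pred0)) => [|[a b] /=]; last by rewrite xpair_eqE; lia.
by rewrite count_pred0 addn0; apply: eq_count => -[a b] /=; rewrite xpair_eqE; lia.
Qed.

Lemma column_length_from_right i j : 1 <= i -> part lam i < j -> column_length_from lam mu i j = 0.
Proof.
move=> i_gt0 lt_j; apply/eqP; rewrite -leqn0 leqNgt -has_count; apply/hasPn => -[a b].
rewrite mem_diagram /= => ab; apply/negP => /andP[le_ia /eqP eq_bj].
by have := leq_part lam_part i_gt0 le_ia; lia.
Qed.

Definition double_columns i :=
  count (fun j => column_length_from lam mu i j == 2) (iota 1 (part lam 1)).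

Let lam_next2 i : 1 <= i <= l -> part lam i.+2 <= part mu i.
Proof.
move=> i_row; case: (ltnP i l) => [lt_il|le_li].
  by have := @row_ge2 i.+1; have := @row_next i.+1; have := @row_next i; lia.
by rewrite (@part_gt_size lam); lia.
Qed.

Lemma column_length_from2 i j : 1 <= i <= l ->
  (column_length_from lam mu i j == 2) =
  ((j == (part mu i).+1) && overlap lam mu i) || (column_length_from lam mu i.+1 j == 2).
Proof.
move=> i_row; have ge2 := row_ge2 i_row; have next := @row_next i; have next2 := lam_next2 i_row.
have le_mu : part mu i.+1 <= part mu i by case: ribbon => _ mu_part _ _; apply: leq_part; lia.
rewrite column_length_fromS mem_diagram.
case: (boolP (part mu i < j <= part lam i)) => [j_row|j_nrow]; last first.
  by rewrite andbF (_ : (j == (part mu i).+1) = false) //; lia.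
rewrite column_length_fromS (@column_length_from_right i.+2); try lia.
by rewrite mem_diagram /overlap; lia.
Qed.

Lemma double_columnsS i : 1 <= i <= l -> double_columns i = overlap lam mu i + double_columns i.+1.
Proof.
move=> i_row; have ge2 := row_ge2 i_row; have next := @row_next i; have next2 := lam_next2 i_row.
rewrite /double_columns; under eq_count => j do rewrite column_length_from2 //.
have -> : overlap lam mu i =
    count (fun j => (j == (part mu i).+1) && overlap lam mu i) (iota 1 (part lam 1)) :> nat.
  case: (overlap lam mu i); last first.
    by rewrite (eq_count (a2 := pred0)) ?count_pred0 // => j; rewrite andbF.
  rewrite (eq_count (a2 := pred1 (part mu i).+1)) => [|j]; last by rewrite andbT.
  rewrite count_uniq_mem ?iota_uniq // mem_iota.
  by have := leq_part lam_part (leqnn 1) (_ : 1 <= i); lia.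
rewrite -count_predUI [X in _ = _ + X](eq_count (a2 := pred0)) ?count_pred0 ?addn0 // => j /=.
by case: eqP => //= ->; rewrite column_length_fromS column_length_from_right; lia.
Qed.

Lemma double_columns_overlaps i : i <= l -> double_columns i.+1 = overlaps_from L i.
Proof.
move=> le_il; have [k] := ubnP (l - i); elim: k i le_il => // k IHk i le_il lt_k.
case: (ltnP i l) => [lt_il|le_li].
  by rewrite double_columnsS // overlaps_fromS nth_ribbon_rows // IHk //; lia.
rewrite /overlaps_from drop_oversize ?size_ribbon_rows //.
rewrite /double_columns (eq_in_count (a2 := pred0)) ?count_pred0 // => j.
by rewrite mem_iota => j_col; rewrite column_length_from_right // (@part_gt_size lam) //; lia.
Qed.

Lemma nth_overlapping_partition i : (overlapping_partition lam mu)`_i = overlaps_from L i.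
Proof.
case: (ltnP i l) => [lt_il|le_li]; last first.
  by rewrite /overlaps_from nth_default ?size_map ?size_iota // drop_oversize ?size_ribbon_rows.
by rewrite (nth_map 0) ?size_iota // nth_iota // -double_columns_overlaps // ltnW.
Qed.

Lemma size_diagram_ribbon : size (diagram lam mu) = sumn (unzip1 L).
Proof. by rewrite size_diagram /unzip1 -map_comp. Qed.

Definition ribbon_coef (nu : seq nat) : int :=
  if nu \in partitions (sumn (unzip1 L)) then Posz (chain_count L false [::] nu) else 0%R.

Lemma ribbon_schur_expansion : is_schur_expansion lam mu ribbon_coef.
Proof.
rewrite /is_schur_expansion size_diagram_ribbon; split=> [n|nu /negbTE nin]; last first.
  by rewrite /ribbon_coef nin.
have rows_gt0 : all (fun r => 0 < r.1) L.
  by apply/allP => r /mapP[i]; rewrite mem_iota => i_row -> /=; have := @row_ge2 i; lia.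
rewrite skew_schur_ribbon_words // ribbon_words_chain ?last_ribbon_rows //.
apply: eq_big_seq => nu mem_nu; have := mem_nu; rewrite mem_partitions => /andP[pn _].
by rewrite schurE // /ribbon_coef mem_nu -natz scaler_nat mulr_natl.
Qed.

Lemma schur_expansion_unique c : is_schur_expansion lam mu c -> c =1 ribbon_coef.
Proof.
have [ex ex0] := ribbon_schur_expansion; case=> ex_c ex_c0 nu.
case: (boolP (nu \in partitions (size (diagram lam mu)))) => [mem_nu|nin]; last first.
  by rewrite ex0 ?ex_c0.
apply/eqP; rewrite -subr_eq0; apply/eqP; move: nu mem_nu.
apply: (@schur_independent _ (fun nu => c nu - ribbon_coef nu)%R).
under eq_bigr => ka _ do rewrite scalerBl.
by rewrite sumrB -ex -ex_c subrr.
Qed.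

Lemma schur_support_admissible nu : partition_ribbon L ->
  in_schur_support lam mu nu <-> admissible L nu.
Proof.
move=> L_ribbon; split=> [[c [/schur_expansion_unique ->]]|adm].
  rewrite /ribbon_coef; case: ifP => //; rewrite mem_partitions ltz_nat => /andP[pn _].
  by case/(chain_count_admissible last_ribbon_rows pn).
exists ribbon_coef; split; first exact: ribbon_schur_expansion.
have [pn [sum_nu _] _] := adm.
by rewrite /ribbon_coef mem_partitions pn -sum_nu eqxx ltz_nat chain_count_gt0.
Qed.

End RibbonSupport.

(** * Admissible partitions and the dominance interval *)

Lemma dominated_take_nth la nu i : dominated la nu -> sumn (take i la) + nu`_i <= sumn la.
Proof.
move=> [-> dom]; apply: leq_trans (leq_sumn_take nu i.+1).
by rewrite sumn_takeS leq_add2r.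
Qed.

Lemma in_dominance_interval_two_rows alpha q nu : q <= sumn alpha ->
  in_dominance_interval alpha [:: sumn alpha - q; q] nu <->
  [/\ is_partition nu, dominated alpha nu & nu`_0 + q <= sumn alpha].
Proof.
move=> le_q; split=> [[pn dom [_ dom_two]]|[pn dom row0]].
  by split=> //; have := dom_two 1; rewrite sumn_takeS take0 /=; lia.
have [sum_nu _] := dom; split=> //; split; first by rewrite /= -sum_nu addn0 subnK.
case=> [|[|k]]; rewrite ?take0 //; first by rewrite sumn_takeS take0 /=; lia.
by apply: leq_trans (leq_sumn_take _ _) _; rewrite /= -sum_nu; lia.
Qed.

Lemma sum_maxn (f : nat -> nat) r k :
  \sum_(j < k) maxn (f j) r = \sum_(j < k) f j + \sum_(j < k) (r - f j).
Proof. by rewrite -big_split; apply: eq_bigr => j _; rewrite maxnE. Qed.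

Lemma dominated_sum_maxn la nu i r : is_partition la -> is_partition nu -> dominated la nu ->
  r <= nu`_i -> \sum_(j < i) maxn la`_j r <= \sum_(j < i) nu`_j.
Proof.
move=> pl pn [_ dom] le_r.
suff dom_prefix k : k <= i -> \sum_(j < k) maxn la`_j r <= \sum_(j < k) nu`_j by apply: dom_prefix.
elim: k => [|k IHk] lt_ki; first by rewrite !big_ord0.
case: (leqP r la`_k) => [le_rk|lt_kr].
  apply: leq_trans (_ : sumn (take k.+1 la) <= _); last by rewrite -sumn_take_sum.
  rewrite sumn_take_sum; apply: leq_sum => j _.
  by have := partition_nth_leq pl (ltn_ord j : j <= k); lia.
rewrite (sum_ord_recr (fun j => maxn la`_j r)) sum_ord_recr; have := IHk (ltnW lt_ki).
by have := partition_nth_leq pn (ltnW lt_ki); lia.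
Qed.

(* [varrho], as a natural number. *)
Definition threshold (L : seq (nat * bool)) i := 1 + cells_from L i - overlaps_from L i.

Section Interval.
Variable L : seq (nat * bool).
Hypothesis L_ribbon : partition_ribbon L.
Notation l := (size L).
Notation al i := ((unzip1 L)`_i).

Let rows_part : is_partition (unzip1 L). Proof. exact: partition_ribbon_partition. Qed.

Let cells_ge i : 2 * (l - i) <= cells_from L i.
Proof. by apply: cells_from_ge; case: L_ribbon. Qed.

Let overlaps_le i : overlaps_from L i <= l - i.+1.
Proof. by apply: overlaps_from_leq; case: L_ribbon. Qed.

Lemma thresholdE i : threshold L i + overlaps_from L i = 1 + cells_from L i.
Proof. by rewrite /threshold; have := cells_ge i; have := overlaps_le i; lia. Qed.

Definition deficit i := \sum_(j < i) (threshold L i - al j).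

Lemma dominated_row_leq nu i : dominated (unzip1 L) nu -> nu`_i <= cells_from L i.
Proof.
move=> /(dominated_take_nth i); rewrite sumn_take_sum -(sum_rows_cells_from L i).
by rewrite leq_add2l.
Qed.

Lemma dominated_row_bound nu i : is_partition nu -> dominated (unzip1 L) nu ->
  overlaps_from L i <= deficit i -> nu`_i + overlaps_from L i <= cells_from L i.
Proof.
move=> pn dom le_deficit; rewrite leqNgt; apply/negP => gt.
have le_row : threshold L i <= nu`_i by have := thresholdE i; lia.
have := dominated_sum_maxn rows_part pn dom le_row; rewrite sum_maxn -/(deficit i).
have [sum_nu _] := dom; have := leq_sumn_take nu i.+1.
rewrite sumn_take_sum -sum_nu -(sum_rows_cells_from L i) sum_ord_recr.
by have := thresholdE i; lia.
Qed.

(* If the inequality of the theorem fails at [i], raising the rows above [i] to the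
   threshold and putting the spare cells in the first row gives a partition that violates the
   bound at [i]. *)
Section Violation.
Variable i : nat.
Hypotheses (i_gt0 : 0 < i) (i_lt : i < l) (lt_deficit : deficit i < overlaps_from L i).

Definition spare := overlaps_from L i - 1 - deficit i.

Definition violating_row j :=
  if j < i then maxn (al j) (threshold L i) + (if j == 0 then spare else 0)
  else if j == i then threshold L i else 0.

Lemma violating_row_nonincreasing : nonincreasing violating_row.
Proof.
move=> j; rewrite /violating_row; have := partition_nonincreasing rows_part j.
case: (ltnP j.+1 i) => [lt_j|le_ij]; first by rewrite (ltnW lt_j) /= addn0; lia.
by case: eqP => // eq_j _; rewrite -eq_j ltnSn; lia.
Qed.

Lemma violating_row_i : violating_row i = threshold L i.
Proof. by rewrite /violating_row ltnn eqxx. Qed.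

Lemma violating_row_default : violating_row i.+1 = 0.
Proof. by rewrite /violating_row ltnNge leqnSn (gtn_eqF (ltnSn i)). Qed.

Lemma sum_violating_row k : 0 < k <= i ->
  \sum_(j < k) violating_row j = \sum_(j < k) maxn (al j) (threshold L i) + spare.
Proof.
case: k => // k /= lt_ki; rewrite sum_ord_recl (sum_ord_recl (fun j => maxn (al j) _)).
rewrite {1}/violating_row i_gt0 /= addnAC; congr (_ + _ + _); apply: eq_bigr => j _.
by rewrite /violating_row (leq_trans _ lt_ki) ?ltnS // addn0.
Qed.

Lemma total_violating_row : \sum_(j < i.+1) violating_row j = sumn (unzip1 L).
Proof.
rewrite sum_ord_recr violating_row_i sum_violating_row ?i_gt0 ?leqnn // sum_maxn -/(deficit i).
by rewrite -(sum_rows_cells_from L i); have := thresholdE i; rewrite /spare; lia.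
Qed.

Lemma violating_row0 : violating_row 0 + overlaps_from L 0 <= sumn (unzip1 L).
Proof.
have := nonincreasing_sum_geq i violating_row_nonincreasing.
rewrite total_violating_row violating_row_i; apply: leq_trans; rewrite leq_add2l.
have thr_ge : (l - i).+1 <= threshold L i.
  by have := thresholdE i; have := cells_ge i; have := overlaps_le i; lia.
apply: leq_trans (leq_mul (leqnn i) thr_ge).
have := overlaps_le 0; have : l - i <= i * (l - i) by rewrite leq_pmull.
by rewrite mulnS; lia.
Qed.

Lemma violating_partition_exists :
  exists nu, [/\ is_partition nu, dominated (unzip1 L) nu,
    nu`_0 + overlaps_from L 0 <= sumn (unzip1 L) & cells_from L i < nu`_i + overlaps_from L i].
Proof.
have row_dec := violating_row_nonincreasing; have row_default := violating_row_default.
have nth_nu := nth_partition_of row_dec row_default.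
exists (partition_of violating_row i.+1); split; first exact: partition_of_partition.
- split=> [|k]; first by rewrite sumn_partition_of // total_violating_row.
  case: (leqP k i) => [le_ki|lt_ik]; last first.
    rewrite [X in _ <= sumn X]take_oversize; last exact: leq_trans (size_partition_of _ _) lt_ik.
    by rewrite sumn_partition_of // total_violating_row leq_sumn_take.
  case: (posnP k) => [->|k_gt0]; first by rewrite !take0.
  rewrite !sumn_take_sum; under [leqRHS]eq_bigr => j _ do rewrite nth_nu.
  rewrite sum_violating_row ?k_gt0 // sum_maxn -addnA; exact: leq_addr.
- by rewrite nth_nu violating_row0.
by rewrite nth_nu violating_row_i thresholdE.
Qed.

End Violation.

Definition overlaps_le_deficits : Prop :=
  forall i, 0 < i -> 0 < overlaps_from L i -> overlaps_from L i <= deficit i.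

Lemma admissible_interval_iff :
  (forall nu, admissible L nu <->
     [/\ is_partition nu, dominated (unzip1 L) nu &
         nu`_0 + overlaps_from L 0 <= sumn (unzip1 L)]) <->
  overlaps_le_deficits.
Proof.
split=> [full i i_gt0 overs_gt0|deficits nu].
  rewrite leqNgt; apply/negP => lt_deficit; have i_lt : i < l by have := overlaps_le i; lia.
  have [nu [pn dom row0 violates]] := violating_partition_exists i_gt0 i_lt lt_deficit.
  have [_ _ /(_ i)] : admissible L nu by apply/full.
  by rewrite leqNgt violates.
split=> [[pn dom bound]|[pn dom row0]]; split=> //.
  by have := bound 0; rewrite /cells_from drop0.
move=> i; case: (posnP i) => [->|i_gt0]; first by rewrite /cells_from drop0.
case: (posnP (overlaps_from L i)) => [->|overs_gt0]; first by rewrite addn0 dominated_row_leq.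
exact: dominated_row_bound pn dom (deficits i i_gt0 overs_gt0).
Qed.

End Interval.

Lemma num_nonzero_gt s i : nonincreasing (nth 0 s) -> (i < num_nonzero s) = (0 < s`_i).
Proof.
move=> s_dec; rewrite -(nth_drop_zeros _ (introT (sorted_geqP s) s_dec)).
rewrite partition_nth_gt0 ?drop_zeros_partition ?size_filter //.
exact/sorted_geqP.
Qed.

Lemma sumn_drop_int (s : seq nat) i :
  (\sum_(i.+1 <= q < (size s).+1) (part s q)%:Z = (sumn (drop i s))%:Z)%R.
Proof.
rewrite big_add1 /= (eq_bigr (fun q => Posz s`_q)) // -(big_morph Posz PoszD (erefl _)).
congr Posz; rewrite sumnE [RHS](big_nth 0) size_drop -{1}[i]add0n big_addn.
by apply: eq_bigr => j _; rewrite nth_drop addnC.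
Qed.

Lemma pos_part_subz (r a : nat) : pos_part (r%:Z - a%:Z)%R = Posz (r - a).
Proof. by rewrite /pos_part; case: leP; lia. Qed.

Lemma varrho_deficitE L p i : partition_ribbon L -> (forall j, p`_j = overlaps_from L j) ->
  ((part p i.+1)%:Z <=
   \sum_(1 <= j < i.+1) pos_part (varrho (unzip1 L) p i - (part (unzip1 L) j)%:Z))%R =
  (overlaps_from L i <= deficit L i).
Proof.
move=> [_ ge2 last_free] pE.
have -> : varrho (unzip1 L) p i = Posz (threshold L i).
  rewrite /varrho sumn_drop_int -/(cells_from L i) /part /= pE /threshold.
  by have := cells_from_ge i ge2; have := overlaps_from_leq i last_free; lia.
rewrite big_add1 /= big_mkord /deficit.
rewrite (eq_bigr (fun j : 'I_i => Posz (threshold L i - (unzip1 L)`_j))) => [|j _]; last first.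
  by rewrite pos_part_subz.
by rewrite -(big_morph Posz PoszD (erefl _)) /part /= pE lez_nat.
Qed.

Lemma varrho_condition_iff L p : partition_ribbon L -> (forall j, p`_j = overlaps_from L j) ->
  (num_nonzero p < 2 \/
   (2 <= num_nonzero p /\
    forall i : nat, 1 <= i <= num_nonzero p - 1 ->
      ((part p i.+1)%:Z <=
       \sum_(1 <= j < i.+1) pos_part (varrho (unzip1 L) p i - (part (unzip1 L) j)%:Z))%R)) <->
  overlaps_le_deficits L.
Proof.
move=> L_ribbon pE; have p_dec : nonincreasing (nth 0 p).
  by move=> j; rewrite !pE [leqRHS]overlaps_fromS leq_addl.
split=> [cond i i_gt0|deficits].
  rewrite -{1}pE -num_nonzero_gt // => lt_i; rewrite -(varrho_deficitE _ L_ribbon pE).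
  by case: cond => [|[_]]; [lia | apply; lia].
case: (ltnP (num_nonzero p) 2) => [|ge2]; [by left | right; split=> // i i_range].
rewrite varrho_deficitE //; apply: deficits; first lia.
by rewrite -pE -num_nonzero_gt //; lia.
Qed.

Theorem theorem1p7 (alpha p lam mu : seq nat)
  (alpha_part : is_partition alpha)
  (alpha_ge2 : all (fun a => 2 <= a) alpha)
  (ribbon_alpha : is_ribbon alpha lam mu)
  (p_overlap : p = overlapping_partition lam mu) :
  (forall nu : seq nat,
     in_schur_support lam mu nu <->
     in_dominance_interval alpha [:: sumn alpha - part p 1; part p 1] nu)
  <->
  (num_nonzero p < 2 \/
   (2 <= num_nonzero p /\
    forall i : nat, 1 <= i <= num_nonzero p - 1 ->
      ((part p i.+1)%:Z <=
       \sum_(1 <= j < i.+1) pos_part (varrho alpha p i - (part alpha j)%:Z))%R)).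
Proof.
have ribbon := is_ribbon_ge2 ribbon_alpha alpha_ge2.
set L := ribbon_rows lam mu 1 (size lam).
have alphaE : alpha = unzip1 L by case: ribbon_alpha => _ _ -> _ _; rewrite /unzip1 -map_comp.
have pE i : p`_i = overlaps_from L i by rewrite p_overlap nth_overlapping_partition.
have L_ribbon : partition_ribbon L.
  by split; [rewrite -alphaE; case/andP: alpha_part | rewrite -alphaE | apply: last_ribbon_rows].
rewrite {}alphaE.
have p1E : part p 1 = overlaps_from L 0 by rewrite /part /= pE.
have overlaps_le : overlaps_from L 0 <= sumn (unzip1 L).
  have [_ ge2 last_free] := L_ribbon; have := cells_from_ge 0 ge2.
  by rewrite /cells_from drop0; have := overlaps_from_leq 0 last_free; lia.
have interval nu := in_dominance_interval_two_rows nu overlaps_le.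
have support nu := schur_support_admissible ribbon nu L_ribbon.
rewrite p1E; apply: iff_trans (iff_sym (varrho_condition_iff L_ribbon pE)).
apply: iff_trans (admissible_interval_iff L_ribbon).
by split=> full nu; [rewrite -support full interval | rewrite support full interval].
Qed.
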